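(* Let $F_n=f_1\cdots f_n$ be a composition sequence generated by a finite subcollection $\mathcal{F}$ of $\mathcal{M}(\mathbb{D})$. Then $(F_n)$ converges ideally to a point $q\in\overline{\mathbb{D}}$. Moreover, $(F_n)$ converges locally uniformly to $q$ on $\overline{\mathbb{D}}\setminus X$, where $$X=\{\alpha_f\in\partial\mathbb{D}: f\in\mathcal{F},\ f_n=f\text{ for infinitely many }n\}.$$ Finally, for each $x\in X$, the sequence $(F_n(x))$ converges to $q$ if and only if $(F_n)$ is of limit-point type.
   Context: $\mathbb{D}$ is the open unit disc; $\mathcal{M}(\mathbb{D})$ is the set of Möbius transformations $f$ with $f(\mathbb{D})\subset\mathbb{D}$, $f(\mathbb{D})\neq\mathbb{D}$. For $f\in\mathcal{M}(\mathbb{D})$: if $f(\mathbb{D})$ is internally tangent to $\mathbb{D}$ (at a unique point), $\alpha_f\in\partial\mathbb{D}$ is the unique point with $f(\alpha_f)\in\partial\mathbb{D}$; otherwise $\alpha_f=0$ (so such $f$ contribute nothing to $X$). The composition sequence is of limit-point type if $\bigcap_n F_n(\overline{\mathbb{D}})$ is a single point. Möbius maps act on $\mathbb{H}^3=\{(x,y,t):t>0\}$ (upper half-space, with $\overline{\mathbb{C}}$ as ideal boundary) via Poincaré extension; $j=(0,0,1)$. A sequence $(F_n)$ with $\rho(j,F_n(j))\to\infty$ ($\rho$ the hyperbolic metric) converges ideally to $p\in\overline{\mathbb{C}}$ if $F_n(j)\to p$ in the chordal metric. Locally uniform convergence is with respect to the chordal metric. *)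

(* Defs.v *)
From Stdlib Require Import Reals List.
Open Scope R_scope.

Definition Cpx : Type := (R * R)%type.
Definition Cre (z : Cpx) : R := fst z.
Definition Cim (z : Cpx) : R := snd z.
Definition C0 : Cpx := (0, 0).
Definition C1 : Cpx := (1, 0).
Definition Cadd (z w : Cpx) : Cpx := (fst z + fst w, snd z + snd w).
Definition Copp (z : Cpx) : Cpx := (- fst z, - snd z).
Definition Csub (z w : Cpx) : Cpx := Cadd z (Copp w).
Definition Cmul (z w : Cpx) : Cpx :=
  (fst z * fst w - snd z * snd w, fst z * snd w + snd z * fst w).
Definition Cconj (z : Cpx) : Cpx := (fst z, - snd z).
Definition Cnorm2 (z : Cpx) : R := fst z * fst z + snd z * snd z.
Definition Cnorm (z : Cpx) : R := sqrt (Cnorm2 z).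
Definition Cscal (r : R) (z : Cpx) : Cpx := (r * fst z, r * snd z).
Definition Cinv (z : Cpx) : Cpx := Cscal (/ Cnorm2 z) (Cconj z).
Definition Cdiv (z w : Cpx) : Cpx := Cmul z (Cinv w).

Definition chordal (z w : Cpx) : R :=
  2 * Cnorm (Csub z w) / sqrt ((1 + Cnorm2 z) * (1 + Cnorm2 w)).

Definition Mob : Type := (Cpx * Cpx * Cpx * Cpx)%type.
Definition mob_a (g : Mob) : Cpx := fst (fst (fst g)).
Definition mob_b (g : Mob) : Cpx := snd (fst (fst g)).
Definition mob_c (g : Mob) : Cpx := snd (fst g).
Definition mob_d (g : Mob) : Cpx := snd g.
Definition mob_det (g : Mob) : Cpx :=
  Csub (Cmul (mob_a g) (mob_d g)) (Cmul (mob_b g) (mob_c g)).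
Definition mob_den (g : Mob) (z : Cpx) : Cpx := Cadd (Cmul (mob_c g) z) (mob_d g).
Definition mob_eval (g : Mob) (z : Cpx) : Cpx :=
  Cdiv (Cadd (Cmul (mob_a g) z) (mob_b g)) (mob_den g z).

Definition in_disc (z : Cpx) : Prop := Cnorm z < 1.
Definition in_cldisc (z : Cpx) : Prop := Cnorm z <= 1.
Definition on_circle (z : Cpx) : Prop := Cnorm z = 1.

Definition in_MD (g : Mob) : Prop :=
  mob_det g <> C0 /\
  (forall z, in_disc z -> mob_den g z <> C0 /\ in_disc (mob_eval g z)) /\
  (exists w, in_disc w /\ forall z, in_disc z -> mob_eval g z <> w).

(* g(D) is internally tangent to the unit circle at a unique point:
   exactly one boundary point is mapped to the boundary *)
Definition tangent (g : Mob) : Prop :=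
  exists x, (on_circle x /\ on_circle (mob_eval g x)) /\
            forall y, on_circle y /\ on_circle (mob_eval g y) -> y = x.

Definition is_alpha (g : Mob) (x : Cpx) : Prop :=
  (tangent g /\ on_circle x /\ on_circle (mob_eval g x)) \/
  (~ tangent g /\ x = C0).

(* ---------- composition sequences (0-indexed: F n = f 0 ∘ ... ∘ f (n-1)) ---------- *)
Fixpoint Fcomp (f : nat -> Mob) (n : nat) (z : Cpx) : Cpx :=
  match n with
  | O => z
  | S m => Fcomp f m (mob_eval (f m) z)
  end.

(* ---------- upper half-space H^3 : points (z, t) with t > 0 ---------- *)
Definition H3 : Type := (Cpx * R)%type.
Definition jpt : H3 := (C0, 1).

(* Poincaré extension of z |-> (az+b)/(cz+d) (quaternion formula, normalised
   to determinant of modulus 1) *)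
Definition mob_ext (g : Mob) (P : H3) : H3 :=
  let z := fst P in let t := snd P in
  let den := Cnorm2 (mob_den g z) + Cnorm2 (mob_c g) * t * t in
  (Cscal (/ den)
     (Cadd (Cmul (Cadd (Cmul (mob_a g) z) (mob_b g)) (Cconj (mob_den g z)))
           (Cscal (t * t) (Cmul (mob_a g) (Cconj (mob_c g))))),
   Cnorm (mob_det g) * t / den).

Fixpoint Fext (f : nat -> Mob) (n : nat) (P : H3) : H3 :=
  match n with
  | O => P
  | S m => Fext f m (mob_ext (f m) P)
  end.

(* hyperbolic metric on H^3: cosh rho = 1 + |P-Q|^2 / (2 t_P t_Q) *)
Definition eucl2_H3 (P Q : H3) : R :=
  Cnorm2 (Csub (fst P) (fst Q)) + (snd P - snd Q) * (snd P - snd Q).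
Definition arcosh (x : R) : R := ln (x + sqrt (x * x - 1)).
Definition rho (P Q : H3) : R :=
  arcosh (1 + eucl2_H3 P Q / (2 * snd P * snd Q)).

(* chordal metric on R^3 ∪ {∞}, between a point of H^3 and a finite point
   p of the ideal boundary Cpx (embedded as (p,0)) *)
Definition chordal3 (P : H3) (p : Cpx) : R :=
  2 * sqrt (eucl2_H3 P (p, 0))
    / sqrt ((1 + Cnorm2 (fst P) + snd P * snd P) * (1 + Cnorm2 p)).

Definition converges_ideally (f : nat -> Mob) (p : Cpx) : Prop :=
  (forall M, exists N, forall n, (n >= N)%nat -> rho jpt (Fext f n jpt) > M) /\
  (forall eps, eps > 0 -> exists N, forall n, (n >= N)%nat ->
     chordal3 (Fext f n jpt) p < eps).

Definition loc_unif_conv (f : nat -> Mob) (S : Cpx -> Prop) (q : Cpx) : Prop :=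
  forall z, S z -> exists r, r > 0 /\
    forall eps, eps > 0 -> exists N, forall n, (n >= N)%nat ->
      forall w, S w -> Cnorm (Csub w z) < r -> chordal (Fcomp f n w) q < eps.

Definition pt_conv (f : nat -> Mob) (x q : Cpx) : Prop :=
  forall eps, eps > 0 -> exists N, forall n, (n >= N)%nat ->
    chordal (Fcomp f n x) q < eps.

Definition limit_point_type (f : nat -> Mob) : Prop :=
  exists p, forall z,
    (forall n, exists w, in_cldisc w /\ Fcomp f n w = z) <-> z = p.

Definition Xset (Fl : list Mob) (f : nat -> Mob) (x : Cpx) : Prop :=
  exists g, In g Fl /\ (forall N, exists n, (n >= N)%nat /\ f n = g) /\
            is_alpha g x /\ on_circle x.

(* Main.v *)
(** Scale the generators so that their determinants have modulus one, and let (c, d) be the bottom row of the matrix of F_n.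
    The disc F_n(D) has radius 1 / m_n, where m_n = |d|^2 - |c|^2 is nondecreasing.
    If m_n is unbounded, the discs shrink to a point and everything is immediate.
    Suppose that m_n is bounded. If f_{n+1} is not tangent, then m_{n+1} - m_n dominates |d|^2 >= 1, so this happens
    finitely often; if f_{n+1}(D) is tangent to D at beta = f_{n+1}(alpha), then m_{n+1} - m_n equals |c beta + d|^2
    times a positive constant of the generator. Since |c beta + d| >= 1 / (2 |d|), the heights of F_n(j), at most
    1 / |d|^2, are summable, which makes F_n(0) and F_n(j) converge to a common point q. Moreover c beta + d -> 0, so the
    pole of F_n approaches the points alpha of the recurrent generators, and F_n -> q uniformly away from them.
    As |c| -> infinity, each beta eventually equals the preceding alpha, hence e = F_n(alpha) is eventually
    constant; the bound on 1 / |e - F_n(0)| = |c beta + d| |d| obtained by summing increments shows that e <> q. *)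
Require Import Defs.
From Stdlib Require Import Reals List.
From Stdlib Require Import Lra Lia Classical FunctionalExtensionality.
From Coquelicot Require Import Coquelicot.
Open Scope R_scope.

(** * Möbius maps over the complex field of Coquelicot *)

Definition ca (g : Mob) : C := mob_a g.
Definition cb (g : Mob) : C := mob_b g.
Definition cc (g : Mob) : C := mob_c g.
Definition cd (g : Mob) : C := mob_d g.
Definition cdet (g : Mob) : C := (ca g * cd g - cb g * cc g)%C.
Definition den (g : Mob) (z : C) : C := (cc g * z + cd g)%C.
Definition ev (g : Mob) (z : C) : C := ((ca g * z + cb g) / den g z)%C.

Lemma Cnorm_Cmod (z : C) : Cnorm z = Cmod z.
Proof. unfold Cnorm, Cnorm2, Cmod; f_equal; ring. Qed.

Lemma Cnorm2_Cmod (z : C) : Cnorm2 z = Cmod z ^ 2.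
Proof. rewrite Cmod2_alt; unfold Cnorm2, Re, Im; ring. Qed.

(** Both inverses are the formula [conj z / |z|^2], so they agree at zero too and the pole needs no
    exception. *)
Lemma mob_eval_ev (g : Mob) (z : C) : mob_eval g z = ev g z.
Proof.
  unfold mob_eval, ev, Defs.Cdiv, Cdiv.
  change (mob_den g z) with (den g z).
  replace (Defs.Cinv (den g z)) with (/ den g z)%C; [reflexivity|].
  generalize (den g z); intros [x y].
  unfold Cinv, Defs.Cinv, Cscal, Defs.Cconj, Cnorm2; simpl.
  replace (x * (x * 1) + y * (y * 1)) with (x * x + y * y) by ring.
  f_equal; unfold Rdiv; ring.
Qed.

Ltac csq := rewrite ?Cmod2_alt; unfold Cminus, Cplus, Cmult, Copp, Cconj, RtoC, Re, Im in *; simpl; ring.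

Lemma Cmod_sqr_lt (x y : C) : Cmod x ^ 2 < Cmod y ^ 2 -> Cmod x < Cmod y.
Proof. intros; apply Rsqr_incrst_0; unfold Rsqr; pose proof (Cmod_ge_0 x); pose proof (Cmod_ge_0 y); nra. Qed.

Lemma Rle_of_sqr (x y : R) : 0 <= y -> x ^ 2 <= y ^ 2 -> x <= y.
Proof. intros; nra. Qed.

Lemma Cmod_pos (z : C) : z <> 0%C -> 0 < Cmod z.
Proof. apply Cmod_gt_0. Qed.

Lemma Cmod_neq0 (z : C) : 0 < Cmod z -> z <> 0%C.
Proof. apply Cmod_gt_0. Qed.

Lemma Cmod_reverse_triangle (x y : C) : Cmod x - Cmod y <= Cmod (x + y)%C.
Proof.
  pose proof (Cmod_triangle (x + y) (- y)).
  replace (x + y + - y)%C with x in H by ring. rewrite Cmod_opp in H. lra.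
Qed.

Lemma Cmod_minus_sym (x y : C) : Cmod (x - y)%C = Cmod (y - x)%C.
Proof. rewrite <- Cmod_opp; f_equal; ring. Qed.

Lemma Cmod_minus_triangle (x y z : C) : Cmod (x - z)%C <= Cmod (x - y)%C + Cmod (y - z)%C.
Proof. replace (x - z)%C with ((x - y) + (y - z))%C by ring; apply Cmod_triangle. Qed.

Lemma Cmod_minus_le0 (x y : C) : Cmod (x - y)%C <= 0 -> x = y.
Proof.
  intros H; pose proof (Cmod_ge_0 (x - y)).
  replace x with ((x - y) + y)%C by ring.
  rewrite (Cmod_eq_0 (x - y)) by lra; ring.
Qed.

(** * The image disc of a Möbius map *)

(** When the determinant has modulus one and [mm g] is positive, [g] maps the unit disc onto the
    disc of centre [kap g] and radius [/ mm g]. The centre is the image of [- conj c / conj d], the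
    reflection of the pole in the unit circle. *)
Definition mm (g : Mob) : R := Cmod (cd g) ^ 2 - Cmod (cc g) ^ 2.
Definition kap (g : Mob) : C :=
  ((cb g * Cconj (cd g) - ca g * Cconj (cc g)) / RtoC (mm g))%C.

(** The matrix with rows [(conj d, conj c)] and [(c, d)] preserves the Hermitian form of signature
    (1,1) up to the factor [mm g]. *)
Lemma den_conj_identity (g : Mob) (w : C) :
  Cmod (den g w) ^ 2 - Cmod (w * Cconj (cd g) + Cconj (cc g))%C ^ 2
  = mm g * (1 - Cmod w ^ 2).
Proof.
  unfold den, mm; generalize (cc g) (cd g).
  intros [c1 c2] [d1 d2]; destruct w; csq.
Qed.

Lemma RtoC_neq0 (x : R) : x <> 0 -> RtoC x <> 0%C.
Proof. intros H E; apply H; injection E; auto. Qed.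

Lemma RtoC_mm (g : Mob) : RtoC (mm g) = (cd g * Cconj (cd g) - cc g * Cconj (cc g))%C.
Proof. unfold mm; rewrite RtoC_minus, <- !Cmod2_conj, !RtoC_pow; ring. Qed.

(** Thus [g] is the map [(w conj d + conj c) / (c w + d)], an automorphism of the disc when [mm g]
    is positive, followed by the affine map of slope [cdet g / mm g] and constant term [kap g]. *)
Lemma ev_minus_center (g : Mob) (w : C) : mm g <> 0 -> den g w <> 0%C ->
  (ev g w - kap g)%C
  = (cdet g * (w * Cconj (cd g) + Cconj (cc g)) / (RtoC (mm g) * den g w))%C.
Proof.
  intros Hm Hd; pose proof (RtoC_neq0 _ Hm) as Hm'.
  unfold ev, kap, cdet.
  assert (E : forall x, x = (x * (RtoC (mm g) * den g w) / (RtoC (mm g) * den g w))%C).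
  { intros; field; auto. }
  rewrite (E (_ - _)%C). f_equal.
  transitivity ((ca g * w + cb g) * RtoC (mm g)
     - (cb g * Cconj (cd g) - ca g * Cconj (cc g)) * den g w)%C.
  - field; auto.
  - rewrite RtoC_mm; unfold den; ring.
Qed.

Lemma ev_center_defect (g : Mob) (w : C) :
  Cmod (cdet g) = 1 -> 0 < mm g -> den g w <> 0%C ->
  (/ mm g) ^ 2 - Cmod (ev g w - kap g)%C ^ 2
  = (1 - Cmod w ^ 2) / (mm g * Cmod (den g w) ^ 2).
Proof.
  intros H1 Hm Hd.
  assert (Hm0 : mm g <> 0) by lra.
  rewrite (ev_minus_center g w Hm0 Hd).
  pose proof (Cmod_pos _ Hd) as Hp.
  rewrite Cmod_div, !Cmod_mult, Cmod_R, H1, Rabs_pos_eq by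
    first [lra | apply Cmult_neq_0; [apply RtoC_neq0 | ]; auto].
  pose proof (den_conj_identity g w) as Hi.
  replace (1 - Cmod w ^ 2) with ((Cmod (den g w) ^ 2 - Cmod (w * Cconj (cd g) + Cconj (cc g))%C ^ 2) / mm g)
    by (rewrite Hi; field; lra).
  field. lra.
Qed.

Lemma den_neq0 (g : Mob) (w : C) : 0 < mm g -> Cmod w <= 1 -> den g w <> 0%C.
Proof.
  intros Hm Hw E; unfold mm, den in *.
  pose proof (Cmod_reverse_triangle (cd g) (cc g * w)) as Ht.
  replace (cd g + cc g * w)%C with (cc g * w + cd g)%C in Ht by ring.
  rewrite E, Cmod_0, Cmod_mult in Ht.
  pose proof (Cmod_ge_0 (cc g)); pose proof (Cmod_ge_0 (cd g)); pose proof (Cmod_ge_0 w).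
  assert (Cmod (cc g) * Cmod w <= Cmod (cc g)) by nra. nra.
Qed.

Lemma ev_in_image_disc (g : Mob) (w : C) :
  Cmod (cdet g) = 1 -> 0 < mm g -> Cmod w <= 1 ->
  Cmod (ev g w - kap g)%C <= / mm g.
Proof.
  intros H1 Hm Hw; pose proof (den_neq0 g w Hm Hw) as Hd.
  pose proof (ev_center_defect g w H1 Hm Hd) as Hi.
  pose proof (Cmod_pos _ Hd); pose proof (Cmod_ge_0 w).
  assert (0 <= (1 - Cmod w ^ 2) / (mm g * Cmod (den g w) ^ 2)).
  { apply Rdiv_le_0_compat; [nra | apply Rmult_lt_0_compat; [|apply pow_lt]; auto]. }
  apply Rle_of_sqr; [left; apply Rinv_0_lt_compat; auto | lra].
Qed.

Definition evinv (g : Mob) (y : C) : C := ((cd g * y - cb g) / (ca g - cc g * y))%C.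

(** For [c] nonzero, the image [a / c] of infinity is [|d| / |c|] radii away from the centre, and
    this exceeds one. *)
Lemma evinv_den (g : Mob) (y : C) :
  Cmod (cdet g) = 1 -> 0 < mm g -> Cmod (y - kap g)%C <= / mm g ->
  (ca g - cc g * y)%C <> 0%C.
Proof.
  intros H1 Hm Hy E.
  assert (Hm' : RtoC (mm g) <> 0%C) by (apply RtoC_neq0, Rgt_not_eq; lra).
  assert (K : (cc g * (y - kap g) * RtoC (mm g))%C = (Cconj (cd g) * cdet g)%C).
  { transitivity (cc g * y * RtoC (mm g) - cc g * (cb g * Cconj (cd g) - ca g * Cconj (cc g)))%C.
    - unfold kap; field; auto.
    - replace (cc g * y)%C with (ca g - (ca g - cc g * y))%C by ring.
      rewrite E, RtoC_mm; unfold cdet; ring. }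
  apply (f_equal Cmod) in K.
  rewrite !Cmod_mult, Cmod_conj, H1, Cmod_R, Rabs_pos_eq in K by lra.
  assert (Cmod (y - kap g)%C * mm g <= 1).
  { replace 1 with (/ mm g * mm g) by (field; lra). apply Rmult_le_compat_r; lra. }
  pose proof (Cmod_ge_0 (y - kap g)); pose proof (Cmod_ge_0 (cc g)); pose proof (Cmod_ge_0 (cd g)).
  assert (Cmod (cd g) <= Cmod (cc g)) by nra.
  unfold mm in Hm; nra.
Qed.

Lemma evinv_spec (g : Mob) (y : C) :
  Cmod (cdet g) = 1 -> 0 < mm g -> Cmod (y - kap g)%C <= / mm g ->
  den g (evinv g y) <> 0%C /\ ev g (evinv g y) = y.
Proof.
  intros H1 Hm Hy; pose proof (evinv_den g y H1 Hm Hy) as Hd.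
  assert (H0 : cdet g <> 0%C) by (apply Cmod_neq0; lra).
  assert (E : den g (evinv g y) = (cdet g / (ca g - cc g * y))%C).
  { unfold den, evinv, cdet; field; auto. }
  assert (den g (evinv g y) <> 0%C).
  { rewrite E; apply Cmult_neq_0; auto. apply Cmod_neq0; rewrite Cmod_inv by auto.
    apply Rinv_0_lt_compat, Cmod_pos; auto. }
  split; auto.
  unfold ev; rewrite E; unfold evinv, cdet in *; field; auto.
Qed.

(** By the defect identity at [evinv g y], the quantities [1 - |evinv g y|^2] and
    [(/ mm g)^2 - |y - kap g|^2] differ by a positive factor. *)
Lemma evinv_cldisc (g : Mob) (y : C) :
  Cmod (cdet g) = 1 -> 0 < mm g -> Cmod (y - kap g)%C <= / mm g ->
  Cmod (evinv g y) <= 1 /\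
  (Cmod (evinv g y) = 1 <-> Cmod (y - kap g)%C = / mm g).
Proof.
  intros H1 Hm Hy; destruct (evinv_spec g y H1 Hm Hy) as [Hd Hev].
  pose proof (ev_center_defect g _ H1 Hm Hd) as Hi; rewrite Hev in Hi.
  pose proof (Cmod_pos _ Hd) as Hp.
  set (s := mm g * Cmod (den g (evinv g y)) ^ 2) in *.
  assert (Hs : 0 < s) by (apply Rmult_lt_0_compat; [|apply pow_lt]; auto).
  assert (K : s * ((/ mm g) ^ 2 - Cmod (y - kap g)%C ^ 2) = 1 - Cmod (evinv g y) ^ 2).
  { rewrite Hi; field; lra. }
  pose proof (Rinv_0_lt_compat _ Hm).
  pose proof (Cmod_ge_0 (evinv g y)); pose proof (Cmod_ge_0 (y - kap g)).
  set (u := Cmod (evinv g y)) in *; set (v := Cmod (y - kap g)%C) in *; set (r := / mm g) in *.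
  assert (0 <= r ^ 2 - v ^ 2) by nra.
  split; [nra|split; intros E].
  - rewrite E in K. assert (r ^ 2 - v ^ 2 = 0) by nra. nra.
  - rewrite E in K. nra.
Qed.

(** * Generators of determinant of modulus one *)

Definition unit_MD (g : Mob) : Prop := in_MD g /\ Cmod (cdet g) = 1.

Lemma in_MD_ev (g : Mob) : in_MD g ->
  (forall z, Cmod z < 1 -> den g z <> 0%C /\ Cmod (ev g z) < 1) /\
  (exists w, Cmod w < 1 /\ forall z, Cmod z < 1 -> ev g z <> w).
Proof.
  intros (_ & H1 & w & Hw & H2); unfold in_disc in *; split.
  - intros z Hz; specialize (H1 z); rewrite mob_eval_ev, !Cnorm_Cmod in H1; exact (H1 Hz).
  - exists w; rewrite Cnorm_Cmod in Hw; split; auto.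
    intros z Hz; specialize (H2 z); rewrite mob_eval_ev, Cnorm_Cmod in H2; auto.
Qed.

(** Otherwise the pole [- d / c] lies in the closed disc, and [g] cannot stay bounded by one near
    it. *)
Lemma unit_MD_mm_pos (g : Mob) : unit_MD g -> 0 < mm g.
Proof.
  intros [HD H1]; destruct (in_MD_ev g HD) as [Hin _].
  unfold mm.
  pose proof (Cmod_ge_0 (ca g)) as a0; pose proof (Cmod_ge_0 (cb g)) as b0;
  pose proof (Cmod_ge_0 (cc g)) as c0; pose proof (Cmod_ge_0 (cd g)) as d0.
  destruct (Rlt_le_dec (Cmod (cc g)) (Cmod (cd g))) as [|Hle]; [nra|exfalso].
  assert (Hc : cc g <> 0%C).
  { intros E; rewrite E, Cmod_0 in Hle.
    assert (Ed : cd g = 0%C) by (apply Cmod_eq_0; lra).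
    unfold cdet in H1; rewrite E, Ed in H1.
    replace (ca g * 0 - cb g * 0)%C with (RtoC 0) in H1 by ring.
    rewrite Cmod_0 in H1; lra. }
  pose proof (Cmod_pos _ Hc) as Hcp.
  (* Boundedness of [g] at the point [z] below will give [t <= (1 - t) * K], whereas the chosen [t]
     satisfies [t / (1 - t) = K + 1]. *)
  set (K := Cmod (cc g) * Cmod (cd g) + Cmod (cb g) * Cmod (cc g)).
  assert (HK : 0 <= K) by (unfold K; nra).
  (* The point [z] approaches the pole from inside the disc as [t] tends to 1. *)
  set (t := (K + 1) / (K + 2)).
  assert (Ht : t * (K + 2) = K + 1) by (unfold t; field; lra).
  assert (0 < t < 1) by (split; nra).
  set (z := (RtoC t * (- cd g / cc g))%C).
  assert (Hz : Cmod z < 1).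
  { unfold z; rewrite Cmod_mult, Cmod_div, Cmod_opp, Cmod_R, Rabs_pos_eq by (auto; lra).
    assert (Cmod (cd g) / Cmod (cc g) <= 1) by (apply Rle_div_l; lra).
    assert (0 <= Cmod (cd g) / Cmod (cc g)) by (apply Rdiv_le_0_compat; lra). nra. }
  destruct (Hin z Hz) as [Hd Hlt].
  unfold ev in Hlt; rewrite Cmod_div in Hlt by auto.
  apply Rlt_div_l in Hlt; [|apply Cmod_pos; auto]. rewrite Rmult_1_l in Hlt.
  assert (E1 : den g z = (cd g * RtoC (1 - t))%C).
  { unfold den, z; rewrite RtoC_minus; field; auto. }
  assert (E2 : (cc g * (ca g * z + cb g) + - (RtoC (1 - t) * (cb g * cc g)))%C = (- (RtoC t * cdet g))%C).
  { unfold z, cdet; rewrite RtoC_minus; field; auto. }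
  rewrite E1, Cmod_mult, Cmod_R, (Rabs_pos_eq (1 - t)) in Hlt by lra.
  apply (f_equal Cmod) in E2.
  pose proof (Cmod_triangle (cc g * (ca g * z + cb g)) (- (RtoC (1 - t) * (cb g * cc g)))) as Htr.
  rewrite E2, !Cmod_opp, !Cmod_mult, !Cmod_R, H1, (Rabs_pos_eq t), (Rabs_pos_eq (1 - t)) in Htr by lra.
  assert (Cmod (cc g) * Cmod (ca g * z + cb g)%C <= Cmod (cc g) * (Cmod (cd g) * (1 - t))).
  { apply Rmult_le_compat_l; lra. }
  assert (t <= (1 - t) * K) by (unfold K; nra).
  nra.
Qed.

Lemma exists_unit_direction (z : C) : exists u : C, Cmod u = 1 /\ z = (RtoC (Cmod z) * u)%C.
Proof.
  destruct (classic (z = 0%C)) as [->|Hz].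
  - exists 1%C; rewrite Cmod_0, Cmod_1; split; auto; ring.
  - exists (z / RtoC (Cmod z))%C; pose proof (Cmod_pos _ Hz).
    assert (RtoC (Cmod z) <> 0%C) by (apply RtoC_neq0, Rgt_not_eq; auto).
    split.
    + rewrite Cmod_div, Cmod_R, Rabs_pos_eq by (auto; lra). field; lra.
    + field; auto.
Qed.

(** The first bound says that the image disc lies in the unit disc; it is tested in the direction of
    [kap g]. If the radius were at least one, the centre would be [0] and the omitted value [w0]
    would be attained. *)
Lemma unit_MD_disc_bounds (g : Mob) : unit_MD g ->
  Cmod (kap g) + / mm g <= 1 /\ 1 < mm g.
Proof.
  intros Hg; pose proof (unit_MD_mm_pos g Hg) as Hm; destruct Hg as [HD H1].
  destruct (in_MD_ev g HD) as [Hin (w0 & Hw0 & Hout)].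
  pose proof (Rinv_0_lt_compat _ Hm) as Hr.
  pose proof (Cmod_ge_0 (kap g)) as k0.
  assert (Hpre : forall y, Cmod (y - kap g)%C < / mm g ->
     exists w, Cmod w < 1 /\ ev g w = y).
  { intros y Hy; exists (evinv g y).
    destruct (evinv_cldisc g y H1 Hm) as [Hle Hiff]; [lra|].
    destruct (evinv_spec g y H1 Hm) as [_ Hev]; [lra|].
    split; auto. destruct Hle as [|E]; auto. apply Hiff in E; lra. }
  assert (Hk : Cmod (kap g) + / mm g <= 1).
  { destruct (Rle_lt_dec (Cmod (kap g) + / mm g) 1) as [|Hgt]; auto; exfalso.
    destruct (exists_unit_direction (kap g)) as (u & Hu & Eu).
    (* The least non-negative [s] for which [kap g + s * u] leaves the open unit disc. *)
    set (s := Rmax 0 (1 - Cmod (kap g))).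
    assert (Hs : 0 <= s < / mm g /\ 1 <= Cmod (kap g) + s).
    { unfold s, Rmax; destruct (Rle_dec 0 (1 - Cmod (kap g))); lra. }
    destruct (Hpre (kap g + RtoC s * u)%C) as (w & Hw & Ew).
    { replace (kap g + RtoC s * u - kap g)%C with (RtoC s * u)%C by ring.
      rewrite Cmod_mult, Hu, Cmod_R, Rabs_pos_eq; lra. }
    destruct (Hin w Hw) as [_ Hlt]; rewrite Ew in Hlt.
    rewrite Eu in Hlt at 1.
    replace (RtoC (Cmod (kap g)) * u + RtoC s * u)%C with (RtoC (Cmod (kap g) + s) * u)%C in Hlt
      by (rewrite RtoC_plus; ring).
    rewrite Cmod_mult, Hu, Cmod_R, Rabs_pos_eq in Hlt; lra. }
  split; auto.
  destruct (Rlt_le_dec 1 (mm g)) as [|Hle]; auto; exfalso.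
  assert (1 <= / mm g) by (rewrite <- Rinv_1; apply Rinv_le_contravar; lra).
  assert (E : kap g = 0%C) by (apply Cmod_eq_0; lra).
  destruct (Hpre w0) as (w & Hw & Ew).
  { rewrite E; replace (w0 - 0)%C with w0 by ring; lra. }
  exact (Hout w Hw Ew).
Qed.

Lemma unit_MD_ev_cldisc (g : Mob) (w : C) : unit_MD g -> Cmod w <= 1 ->
  den g w <> 0%C /\ Cmod (ev g w) <= Cmod (kap g) + / mm g.
Proof.
  intros Hg Hw; destruct (unit_MD_disc_bounds g Hg) as [Hk Hm]; destruct Hg as [HD H1].
  split; [apply den_neq0; auto; lra|].
  pose proof (ev_in_image_disc g w H1) as Hi.
  pose proof (Cmod_triangle (ev g w - kap g) (kap g)) as Ht.
  replace (ev g w - kap g + kap g)%C with (ev g w) in Ht by ring.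
  specialize (Hi ltac:(lra) Hw); lra.
Qed.

Lemma unit_MD_ev_le1 (g : Mob) (w : C) : unit_MD g -> Cmod w <= 1 -> Cmod (ev g w) <= 1.
Proof.
  intros Hg Hw; destruct (unit_MD_disc_bounds g Hg); destruct (unit_MD_ev_cldisc g w Hg Hw); lra.
Qed.

(** * Tangent generators *)

(** Internal tangency of the image disc to the unit circle. For such maps [bet g] is the point of
    tangency and [alp g] is its preimage, the point written alpha in the theorem. *)
Definition touching (g : Mob) : Prop := Cmod (kap g) + / mm g = 1.
Definition bet (g : Mob) : C := (kap g / RtoC (Cmod (kap g)))%C.
Definition alp (g : Mob) : C := evinv g (bet g).

Lemma touching_bet (g : Mob) : unit_MD g -> touching g ->
  Cmod (bet g) = 1 /\ kap g = (RtoC (1 - / mm g) * bet g)%C.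
Proof.
  intros Hg Ht; destruct (unit_MD_disc_bounds g Hg) as [_ Hm]; unfold touching in Ht.
  assert (/ mm g < 1) by (rewrite <- Rinv_1; apply Rinv_lt_contravar; lra).
  assert (0 < Cmod (kap g)) by lra.
  assert (RtoC (Cmod (kap g)) <> 0%C) by (apply RtoC_neq0, Rgt_not_eq; auto).
  unfold bet; split.
  - rewrite Cmod_div, Cmod_R, Rabs_pos_eq by (auto; lra). field; lra.
  - replace (1 - / mm g) with (Cmod (kap g)) by lra. field; auto.
Qed.

Lemma touching_bet_center (g : Mob) : unit_MD g -> touching g ->
  Cmod (bet g - kap g)%C = / mm g.
Proof.
  intros Hg Ht; destruct (touching_bet g Hg Ht) as [Hb Ek].
  destruct (unit_MD_disc_bounds g Hg) as [_ Hm].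
  rewrite Ek; replace (bet g - RtoC (1 - / mm g) * bet g)%C with (RtoC (/ mm g) * bet g)%C
    by (rewrite RtoC_minus; ring).
  rewrite Cmod_mult, Hb, Cmod_R, Rabs_pos_eq; [ring|].
  left; apply Rinv_0_lt_compat; lra.
Qed.

Lemma touching_alp (g : Mob) : unit_MD g -> touching g ->
  Cmod (alp g) = 1 /\ den g (alp g) <> 0%C /\ ev g (alp g) = bet g.
Proof.
  intros Hg Ht; pose proof (touching_bet_center g Hg Ht) as Hb.
  pose proof (unit_MD_mm_pos g Hg) as Hm; destruct Hg as [_ H1].
  destruct (evinv_cldisc g (bet g) H1 Hm) as [_ Hi]; [lra|].
  destruct (evinv_spec g (bet g) H1 Hm) as [Hd He]; [lra|].
  repeat split; auto. apply Hi; auto.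
Qed.

Lemma ev_inj (g : Mob) (z w : C) : cdet g <> 0%C -> den g z <> 0%C -> den g w <> 0%C ->
  ev g z = ev g w -> z = w.
Proof.
  intros H0 Hz Hw E.
  assert (K : (cdet g * (z - w) = 0)%C).
  { transitivity ((ev g z - ev g w) * (den g z * den g w))%C.
    - unfold ev, cdet, den in *; field; auto.
    - rewrite E; ring. }
  destruct (classic ((z - w)%C = 0%C)) as [K'|K'];
    [clear K; rename K' into K | destruct (Cmult_neq_0 _ _ H0 K' K)].
  replace z with ((z - w) + w)%C by ring; rewrite K; ring.
Qed.

(* Strict convexity of the unit disc. *)
Lemma unit_point_in_tangent_disc (y b : C) (r : R) : Cmod y = 1 -> Cmod b = 1 -> r < 1 ->
  Cmod (y - RtoC (1 - r) * b)%C <= r -> y = b.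
Proof.
  intros Hy Hb Hr H.
  pose proof (Cmod_ge_0 (y - RtoC (1 - r) * b)) as H0.
  (* Stewart's identity for the convex combination of [y - b] and [y] with weights [1 - r] and [r];
     on unit vectors the last two terms add up to [r ^ 2]. *)
  assert (E : Cmod (y - RtoC (1 - r) * b)%C ^ 2
     = (1 - r) * Cmod (y - b)%C ^ 2 + r * Cmod y ^ 2 - r * (1 - r) * Cmod b ^ 2) by csq.
  rewrite Hy, Hb in E.
  pose proof (Cmod_ge_0 (y - b)) as H2.
  assert (Cmod (y - RtoC (1 - r) * b)%C ^ 2 <= r ^ 2) by nra.
  assert (Cmod (y - b)%C ^ 2 <= 0) by nra.
  apply Cmod_minus_le0; nra.
Qed.

(** A boundary value forces tangency, strict convexity identifies it with [bet g], and injectivity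
    then determines [x]. *)
Lemma unit_MD_boundary_point (g : Mob) (x : C) : unit_MD g ->
  Cmod x = 1 -> Cmod (ev g x) = 1 -> touching g /\ x = alp g.
Proof.
  intros Hg Hx He.
  destruct (unit_MD_ev_cldisc g x Hg) as [Hd Hl]; [lra|].
  destruct (unit_MD_disc_bounds g Hg) as [Hk Hm].
  assert (Ht : touching g) by (unfold touching; lra).
  split; auto.
  destruct (touching_bet g Hg Ht) as [Hb Ek].
  destruct (touching_alp g Hg Ht) as (Ha & Hda & Hea).
  assert (E : ev g x = bet g).
  { apply unit_point_in_tangent_disc with (r := / mm g); auto.
    - rewrite <- Rinv_1; apply Rinv_lt_contravar; lra.
    - rewrite <- Ek; apply ev_in_image_disc; try lra; apply Hg. }
  apply (ev_inj g); auto.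
  - apply Cmod_neq0; destruct Hg as [_ ->]; lra.
  - rewrite E, Hea; auto.
Qed.

Lemma is_alpha_alp (g : Mob) : unit_MD g -> touching g -> is_alpha g (alp g) /\ on_circle (alp g).
Proof.
  intros Hg Ht; destruct (touching_alp g Hg Ht) as (Ha & _ & Hea).
  destruct (touching_bet g Hg Ht) as [Hb _].
  assert (on_circle (alp g) /\ on_circle (mob_eval g (alp g))).
  { unfold on_circle; rewrite mob_eval_ev, !Cnorm_Cmod, Hea; auto. }
  split; [left; split|]; try tauto.
  exists (alp g); split; auto.
  intros y [Hy1 Hy2]; unfold on_circle in *; rewrite mob_eval_ev, Cnorm_Cmod in Hy2.
  rewrite Cnorm_Cmod in Hy1.
  apply (unit_MD_boundary_point g y); auto.
Qed.

Lemma is_alpha_unique (g : Mob) (x : C) : unit_MD g -> is_alpha g x -> on_circle x ->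
  touching g /\ x = alp g.
Proof.
  intros Hg [(_ & H1 & H2)|[_ E]] Hx.
  - unfold on_circle in *; rewrite mob_eval_ev, Cnorm_Cmod in H2; rewrite Cnorm_Cmod in H1.
    apply unit_MD_boundary_point; auto.
  - exfalso; unfold on_circle in Hx; rewrite E, Cnorm_Cmod in Hx.
    change C0 with (RtoC 0) in Hx; rewrite Cmod_0 in Hx; lra.
Qed.

(** * Growth of the reciprocal radius *)

(** The left side is the form [|d|^2 - |c|^2] after the row [(c, d)] has been multiplied by the
    matrix of [g]. For [c] nonzero, the right side is [mm g * |c|^2] times the power of the pole
    [- d / c] with respect to the circle of centre [kap g] and radius [/ mm g]. *)
Lemma row_form_center (g : Mob) (c d : C) : Cmod (cdet g) = 1 -> mm g <> 0 ->
  Cmod (c * cb g + d * cd g)%C ^ 2 - Cmod (c * ca g + d * cc g)%C ^ 2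
  = mm g * Cmod (c * kap g + d)%C ^ 2 - Cmod c ^ 2 / mm g.
Proof.
  intros H1 Hm.
  assert (Hm' : RtoC (mm g) <> 0%C) by (apply RtoC_neq0; auto).
  apply (Rmult_eq_reg_l (mm g)); auto.
  replace (mm g * (mm g * Cmod (c * kap g + d)%C ^ 2 - Cmod c ^ 2 / mm g))
    with (mm g ^ 2 * Cmod (c * kap g + d)%C ^ 2 - Cmod c ^ 2) by (field; auto).
  rewrite <- (pow2_abs (mm g)), <- Cmod_R, <- Rpow_mult_distr, <- Cmod_mult.
  replace (RtoC (mm g) * (c * kap g + d))%C
    with (c * (cb g * Cconj (cd g) - ca g * Cconj (cc g)) + d * RtoC (mm g))%C
    by (unfold kap; field; auto).
  replace (Cmod c ^ 2) with (Cmod c ^ 2 * Cmod (cdet g) ^ 2) by (rewrite H1; ring).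
  unfold mm, cdet; rewrite !Cmod2_alt.
  generalize (ca g) (cb g) (cc g) (cd g); intros [] [] [] []; destruct c, d.
  unfold Cminus, Cplus, Cmult, Copp, Cconj, RtoC, Re, Im in *; simpl; ring.
Qed.

(** The centre [(1 - / mm g) * bet g] lies on the segment from [0] to [bet g], so Stewart's identity
    expresses the new form through [|c * bet g + d|^2] and the old form. *)
Lemma touching_row_growth (g : Mob) (c d : C) : unit_MD g -> touching g ->
  Cmod (c * cb g + d * cd g)%C ^ 2 - Cmod (c * ca g + d * cc g)%C ^ 2
  - (Cmod d ^ 2 - Cmod c ^ 2) = (mm g - 1) * Cmod (c * bet g + d)%C ^ 2.
Proof.
  intros Hg Ht; destruct (touching_bet g Hg Ht) as [Hb Ek].
  destruct (unit_MD_disc_bounds g Hg) as [_ Hm].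
  rewrite row_form_center by (try apply Rgt_not_eq; try apply Hg; lra).
  rewrite Ek.
  replace (c * (RtoC (1 - / mm g) * bet g))%C with (RtoC (1 - / mm g) * (c * bet g))%C by ring.
  replace (Cmod c ^ 2) with (Cmod (c * bet g)%C ^ 2) by (rewrite Cmod_mult, Hb; ring).
  assert (E : Cmod (RtoC (1 - / mm g) * (c * bet g) + d)%C ^ 2
    = (1 - / mm g) * Cmod (c * bet g + d)%C ^ 2 + / mm g * Cmod d ^ 2
      - / mm g * (1 - / mm g) * Cmod (c * bet g)%C ^ 2).
  { generalize (c * bet g)%C; generalize (/ mm g); intros r z; csq. }
  rewrite E; field; lra.
Qed.

(** The gap [e] between the image disc and the unit circle makes the growth comparable with [|d|^2].
    The extreme case has [|c * kap g + d| = |d| - |c| * |kap g|]. *)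
Lemma nontouching_row_growth (g : Mob) : unit_MD g -> ~ touching g ->
  exists K, 0 < K /\ forall c d : C, Cmod c <= Cmod d ->
  Cmod d ^ 2 <= K * (Cmod (c * cb g + d * cd g)%C ^ 2 - Cmod (c * ca g + d * cc g)%C ^ 2
                     - (Cmod d ^ 2 - Cmod c ^ 2)).
Proof.
  intros Hg Ht; destruct (unit_MD_disc_bounds g Hg) as [Hk Hm]; unfold touching in Ht.
  set (k := Cmod (kap g)) in *; set (r := / mm g) in *.
  assert (Hr : 0 < r < 1).
  { split; [apply Rinv_0_lt_compat; lra|]; unfold r; rewrite <- Rinv_1; apply Rinv_lt_contravar; lra. }
  assert (k0 : 0 <= k) by apply Cmod_ge_0.
  set (e := 1 - r - k); assert (He : 0 < e) by (unfold e; lra).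
  exists (4 / e); split; [apply Rdiv_lt_0_compat; lra|].
  intros c d Hcd.
  rewrite row_form_center by (try apply Rgt_not_eq; try apply Hg; lra).
  pose proof (Cmod_reverse_triangle d (c * kap g)) as Hrt.
  replace (d + c * kap g)%C with (c * kap g + d)%C in Hrt by ring.
  rewrite Cmod_mult in Hrt; fold k in Hrt.
  pose proof (Cmod_ge_0 c) as c0; pose proof (Cmod_ge_0 d) as d0.
  pose proof (Cmod_ge_0 (c * kap g + d)) as p0.
  set (x := Cmod c) in *; set (y := Cmod d) in *; set (p := Cmod (c * kap g + d)%C) in *.
  assert (0 <= y - x * k) by nra.
  assert (Hp : (y - x * k) ^ 2 <= p ^ 2) by nra.
  unfold Rdiv at 2; fold r.
  assert (Em : mm g = / r) by (unfold r; rewrite Rinv_inv; auto).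
  rewrite Em.
  replace (4 / e * (/ r * p ^ 2 - x ^ 2 * r - (y ^ 2 - x ^ 2)))
    with ((p ^ 2 - x ^ 2 * r ^ 2 - r * (y ^ 2 - x ^ 2)) * (4 / (e * r))) by (field; lra).
  assert (Q : e * r / 4 * y ^ 2 <= p ^ 2 - x ^ 2 * r ^ 2 - r * (y ^ 2 - x ^ 2)).
  { apply Rle_trans with ((y - x * k) ^ 2 - x ^ 2 * r ^ 2 - r * (y ^ 2 - x ^ 2)); [|lra].
    (* With [k] eliminated every term is non-negative, and since [e * r <= 1 - r] the first and
       third terms already dominate [e * r * y ^ 2 / 4]. *)
    assert (Q1 : (y - x * k) ^ 2 - x ^ 2 * r ^ 2 - r * (y ^ 2 - x ^ 2)
      = (1 - r) * (y - x) ^ 2 + 2 * e * (x * (y - x)) + 2 * e * r * x ^ 2 + e ^ 2 * x ^ 2).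
    { replace k with (1 - r - e) by (unfold e; ring). ring. }
    rewrite Q1.
    assert (0 <= x * (y - x)) by nra.
    assert (0 <= e * (x * (y - x))) by nra.
    assert (0 <= e ^ 2 * x ^ 2) by nra.
    assert (0 <= e * r) by nra.
    assert (e * r <= 1 - r) by (unfold e; nra).
    assert (e * r * (y ^ 2 / 4) <= e * r * ((y - x) ^ 2 + 2 * x ^ 2)).
    { apply Rmult_le_compat_l; auto; nra. }
    assert (e * r * (y - x) ^ 2 <= (1 - r) * (y - x) ^ 2).
    { apply Rmult_le_compat_r; auto; nra. }
    nra. }
  replace (y ^ 2) with (e * r / 4 * y ^ 2 * (4 / (e * r))) at 1 by (field; lra).
  apply Rmult_le_compat_r; auto.
  left; apply Rdiv_lt_0_compat; nra.
Qed.

(** * Products of generators *)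

Definition mobmul (g h : Mob) : Mob :=
  ((ca g * ca h + cb g * cc h, ca g * cb h + cb g * cd h,
    (cc g * ca h + cd g * cc h)), cc g * cb h + cd g * cd h)%C.

Fixpoint prodmob (f : nat -> Mob) (n : nat) : Mob :=
  match n with
  | O => ((RtoC 1, RtoC 0, RtoC 0), RtoC 1)
  | S m => mobmul (prodmob f m) (f m)
  end.

Lemma cdet_mobmul (g h : Mob) : cdet (mobmul g h) = (cdet g * cdet h)%C.
Proof. unfold cdet, mobmul; cbn; unfold ca, cb, cc, cd; ring. Qed.

Lemma den_mobmul (g h : Mob) (z : C) : den h z <> 0%C ->
  den (mobmul g h) z = (den g (ev h z) * den h z)%C.
Proof.
  intros H; unfold ev, den in *; cbn; field; auto.
Qed.

Lemma ev_mobmul (g h : Mob) (z : C) : den h z <> 0%C -> den g (ev h z) <> 0%C ->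
  ev (mobmul g h) z = ev g (ev h z).
Proof.
  intros Hh Hg; unfold ev at 1; rewrite den_mobmul by auto.
  unfold ev at 2.
  replace (ca (mobmul g h) * z + cb (mobmul g h))%C
    with ((ca g * ev h z + cb g) * den h z)%C.
  - field; auto.
  - unfold ev, den in *; cbn; field; auto.
Qed.

Lemma row_growth_nonneg (g : Mob) (c d : C) : unit_MD g -> Cmod c <= Cmod d ->
  0 <= Cmod (c * cb g + d * cd g)%C ^ 2 - Cmod (c * ca g + d * cc g)%C ^ 2
       - (Cmod d ^ 2 - Cmod c ^ 2).
Proof.
  intros Hg Hcd; destruct (classic (touching g)) as [Ht|Ht].
  - rewrite touching_row_growth by auto.
    destruct (unit_MD_disc_bounds g Hg).
    apply Rmult_le_pos; [lra | apply pow2_ge_0].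
  - destruct (nontouching_row_growth g Hg Ht) as (K & HK & H).
    specialize (H c d Hcd); pose proof (pow2_ge_0 (Cmod d)).
    nra.
Qed.

Lemma mm_mobmul (g h : Mob) :
  mm (mobmul g h) = Cmod (cc g * cb h + cd g * cd h)%C ^ 2 - Cmod (cc g * ca h + cd g * cc h)%C ^ 2.
Proof. reflexivity. Qed.

Lemma mm_pos_Cmod_lt (g : Mob) : 0 < mm g -> Cmod (cc g) < Cmod (cd g).
Proof. intros H; apply Cmod_sqr_lt; unfold mm in H; lra. Qed.

Lemma prodmob_bounds (f : nat -> Mob) (n : nat) : (forall n, unit_MD (f n)) ->
  Cmod (cdet (prodmob f n)) = 1 /\ 1 <= mm (prodmob f n) /\
  mm (prodmob f n) <= mm (prodmob f (S n)).
Proof.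
  intros Hf.
  assert (Hstep : forall n, 1 <= mm (prodmob f n) -> mm (prodmob f n) <= mm (prodmob f (S n))).
  { intros k Hk; cbn [prodmob]; rewrite mm_mobmul.
    pose proof (mm_pos_Cmod_lt (prodmob f k) ltac:(lra)) as Hlt.
    pose proof (row_growth_nonneg (f k) (cc (prodmob f k)) (cd (prodmob f k)) (Hf k) ltac:(lra)).
    unfold mm at 1; lra. }
  induction n as [|n (IH1 & IH2 & IH3)].
  - assert (E : mm (prodmob f 0) = 1).
    { unfold mm; cbn; unfold cc, cd; cbn; rewrite Cmod_1, Cmod_0; ring. }
    split; [|split].
    + unfold cdet; cbn; unfold ca, cb, cc, cd; cbn.
      replace (1 * 1 - 0 * 0)%C with (RtoC 1) by ring. apply Cmod_1.
    + lra.
    + apply Hstep; lra.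
  - split; [|split].
    + cbn [prodmob]; rewrite cdet_mobmul, Cmod_mult, IH1, (proj2 (Hf n)); ring.
    + lra.
    + apply Hstep; lra.
Qed.

(** On the closed disc no denominator met along the composition vanishes, so the matrix product
    computes it. *)
Lemma Fcomp_prodmob (f : nat -> Mob) (n : nat) (w : C) : (forall n, unit_MD (f n)) ->
  Cmod w <= 1 -> Fcomp f n w = ev (prodmob f n) w.
Proof.
  intros Hf; revert w; induction n as [|n IH]; intros w Hw.
  - unfold ev, den; cbn; unfold ca, cb, cc, cd; cbn.
    change (w = ((1 * w + 0) / (0 * w + 1))%C).
    replace (0 * w + 1)%C with (RtoC 1) by ring; field.
  - cbn [Fcomp prodmob]; rewrite mob_eval_ev.
    pose proof (unit_MD_ev_le1 (f n) w (Hf n) Hw) as Hw'.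
    destruct (unit_MD_ev_cldisc (f n) w (Hf n) Hw) as [Hd _].
    destruct (prodmob_bounds f n Hf) as (_ & Hm & _).
    change (Fcomp f n (ev (f n) w) = ev (mobmul (prodmob f n) (f n)) w).
    rewrite ev_mobmul; auto.
    apply den_neq0; auto; lra.
Qed.

(** * Poincaré extension *)

Definition extden (g : Mob) (z : C) (t : R) : R := Cmod (den g z) ^ 2 + Cmod (cc g) ^ 2 * t ^ 2.

Lemma mob_ext_C (g : Mob) (z : C) (t : R) :
  mob_ext g (z, t) =
  ((((ca g * z + cb g) * Cconj (den g z) + RtoC (t ^ 2) * (ca g * Cconj (cc g)))
      / RtoC (extden g z t))%C,
   Cmod (cdet g) * t / extden g z t).
Proof.
  unfold mob_ext; cbn [fst snd].
  rewrite !Cnorm2_Cmod.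
  change (Cnorm (mob_det g)) with (Cnorm (cdet g)); rewrite Cnorm_Cmod.
  change (Cmod (mob_den g z)) with (Cmod (den g z)).
  change (mob_c g) with (cc g).
  replace (Cmod (den g z) ^ 2 + Cmod (cc g) ^ 2 * t * t) with (extden g z t)
    by (unfold extden; ring).
  f_equal.
  assert (Hs : forall r w, Cscal r w = (RtoC r * w)%C).
  { intros r w; destruct w; unfold Cscal, Cmult, RtoC; simpl; f_equal; ring. }
  rewrite !Hs, Cmult_comm; unfold Cdiv.
  assert (Hi : RtoC (/ extden g z t) = (/ RtoC (extden g z t))%C).
  { generalize (extden g z t); intros r; unfold Cinv, RtoC; simpl.
    destruct (Req_dec r 0) as [->|Hr].
    - unfold Rdiv; rewrite Rinv_0; f_equal; ring.
    - f_equal; field; auto. }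
  rewrite Hi; f_equal.
  replace (t ^ 2) with (t * t) by ring. reflexivity.
Qed.

Lemma RtoC_extden (g : Mob) (z : C) (t : R) :
  RtoC (extden g z t) = (den g z * Cconj (den g z) + cc g * Cconj (cc g) * RtoC (t ^ 2))%C.
Proof. unfold extden; rewrite RtoC_plus, RtoC_mult, !RtoC_pow, <- !Cmod2_conj, !RtoC_pow; ring. Qed.

Lemma extden_pos (g : Mob) (z : C) (t : R) : cdet g <> 0%C -> 0 < t -> 0 < extden g z t.
Proof.
  intros H0 Ht; unfold extden.
  pose proof (pow2_ge_0 (Cmod (den g z))) as H1.
  destruct (classic (cc g = 0%C)) as [E|E].
  - assert (0 < Cmod (den g z)).
    { apply Cmod_pos; intros Hd; apply H0.
      unfold den in Hd; rewrite E in Hd; unfold cdet; rewrite E.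
      replace (cd g) with (0 * z + cd g)%C by ring; rewrite Hd; ring. }
    rewrite E, Cmod_0; nra.
  - pose proof (Cmod_pos _ E).
    assert (0 < Cmod (cc g) ^ 2 * t ^ 2) by (apply Rmult_lt_0_compat; apply pow_lt; auto).
    lra.
Qed.

Lemma Cconj_RtoC (r : R) : Cconj (RtoC r) = RtoC r.
Proof. unfold Cconj, RtoC; simpl; f_equal; ring. Qed.

(* Both coordinates reduce to the polarised Lagrange identity for the vectors
   [(conj (den h z), t conj c_h)] and [(c (a_h z + b_h) + d (den h z), t (c a_h + d c_h))]. *)
Lemma mob_ext_mobmul (g h : Mob) (z : C) (t : R) :
  cdet g <> 0%C -> cdet h <> 0%C -> 0 < t ->
  mob_ext g (mob_ext h (z, t)) = mob_ext (mobmul g h) (z, t).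
Proof.
  intros Hg Hh Ht.
  assert (Hgh : cdet (mobmul g h) <> 0%C) by (rewrite cdet_mobmul; apply Cmult_neq_0; auto).
  pose proof (extden_pos h z t Hh Ht) as HN.
  pose proof (extden_pos (mobmul g h) z t Hgh Ht) as HN2.
  rewrite (mob_ext_C h).
  set (U := ((ca h * z + cb h) * Cconj (den h z) + RtoC (t ^ 2) * (ca h * Cconj (cc h)))%C).
  pose proof (RtoC_extden h z t) as EN; pose proof (RtoC_extden (mobmul g h) z t) as EN2.
  set (N := extden h z t) in *; set (N2 := extden (mobmul g h) z t) in *.
  assert (HNC : RtoC N <> 0%C) by (apply RtoC_neq0; lra).
  assert (HN2C : RtoC N2 <> 0%C) by (apply RtoC_neq0; lra).
  assert (Edet : RtoC (Cmod (cdet h) ^ 2) = (cdet h * Cconj (cdet h))%C)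
    by apply Cmod2_conj.
  assert (Eden : den g (U / RtoC N) = ((cc g * U + cd g * RtoC N) / RtoC N)%C)
    by (unfold den; field; auto).
  assert (Ecden : Cconj (den g (U / RtoC N)) = ((Cconj (cc g) * Cconj U + Cconj (cd g) * RtoC N) / RtoC N)%C).
  { rewrite Eden, Cdiv_conj, Cplus_conj, !Cmult_conj, Cconj_RtoC by auto; reflexivity. }
  assert (EU : Cconj U = (Cconj (ca h * z + cb h) * den h z + RtoC (t ^ 2) * (Cconj (ca h) * cc h))%C).
  { unfold U; rewrite Cplus_conj, !Cmult_conj, !Cconj_conj, Cconj_RtoC; reflexivity. }
  assert (Et : RtoC ((Cmod (cdet h) * t / N) ^ 2)
               = (cdet h * Cconj (cdet h) * RtoC (t ^ 2) / (RtoC N * RtoC N))%C).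
  { replace ((Cmod (cdet h) * t / N) ^ 2) with (Cmod (cdet h) ^ 2 * t ^ 2 / (N * N)) by (field; lra).
    rewrite RtoC_div, !RtoC_mult, Edet by nra; reflexivity. }
  assert (EN' : extden g (U / RtoC N)%C (Cmod (cdet h) * t / N) = N2 / N).
  { apply RtoC_inj; rewrite RtoC_extden, RtoC_div, EN2, Et, Ecden, Eden by lra.
    transitivity (((cc g * U + cd g * RtoC N) * (Cconj (cc g) * Cconj U + Cconj (cd g) * RtoC N)
      + cc g * Cconj (cc g) * (cdet h * Cconj (cdet h) * RtoC (t ^ 2))) / (RtoC N * RtoC N))%C.
    - rewrite EU; field; auto.
    - rewrite EU.
      transitivity (RtoC N * (den (mobmul g h) z * Cconj (den (mobmul g h) z) +
        cc (mobmul g h) * Cconj (cc (mobmul g h)) * RtoC (t ^ 2)) / (RtoC N * RtoC N))%C; [|field; auto].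
      f_equal.
      unfold U; rewrite EN.
      unfold den, cdet, mobmul, ca, cb, cc, cd; cbn.
      unfold Cminus; repeat rewrite ?Cplus_conj, ?Cmult_conj, ?Copp_conj. ring. }
  rewrite !mob_ext_C, EN'; fold N2.
  f_equal.
  - rewrite Et, Ecden, EU, RtoC_div by lra.
    transitivity (((ca g * U + cb g * RtoC N) * (Cconj (cc g) * Cconj U + Cconj (cd g) * RtoC N)
      + ca g * Cconj (cc g) * (cdet h * Cconj (cdet h) * RtoC (t ^ 2))) / (RtoC N * RtoC N2))%C.
    + rewrite EU; field; auto.
    + rewrite EU.
      transitivity (RtoC N * ((ca (mobmul g h) * z + cb (mobmul g h)) * Cconj (den (mobmul g h) z) +
        RtoC (t ^ 2) * (ca (mobmul g h) * Cconj (cc (mobmul g h)))) / (RtoC N * RtoC N2))%C; [|field; auto].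
      f_equal.
      unfold U; rewrite EN.
      unfold den, cdet, mobmul, ca, cb, cc, cd; cbn.
      unfold Cminus; repeat rewrite ?Cplus_conj, ?Cmult_conj, ?Copp_conj. ring.
  - rewrite cdet_mobmul, Cmod_mult; field; lra.
Qed.

Lemma Fext_prodmob (f : nat -> Mob) (n : nat) (z : C) (t : R) : (forall n, unit_MD (f n)) ->
  0 < t -> Fext f n (z, t) = mob_ext (prodmob f n) (z, t).
Proof.
  intros Hf; revert z t; induction n as [|n IH]; intros z t Ht.
  - rewrite mob_ext_C; cbn [Fext prodmob]; unfold extden, den, cdet, ca, cb, cc, cd; cbn.
    replace (1 * 1 - 0 * 0)%C with (RtoC 1) by ring.
    replace (0 * z + 1)%C with (RtoC 1) by ring.
    rewrite Cmod_0, Cmod_1, !Cconj_RtoC.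
    replace (1 * (1 * 1) + 0 * (0 * 1) * (t * (t * 1))) with 1 by ring.
    f_equal; [|field].
    field.
  - assert (Hdet : forall g, Cmod (cdet g) = 1 -> cdet g <> 0%C)
      by (intros g E; apply Cmod_neq0; lra).
    pose proof (Hdet _ (proj1 (prodmob_bounds f n Hf))).
    pose proof (Hdet _ (proj2 (Hf n))).
    cbn [Fext prodmob]; rewrite <- mob_ext_mobmul by auto.
    rewrite (mob_ext_C (f n)); apply IH.
    apply Rdiv_lt_0_compat; [|apply extden_pos; auto].
    rewrite (proj2 (Hf n)); lra.
Qed.

(** * Ideal convergence *)

Definition Ctends (u : nat -> C) (q : C) : Prop :=
  forall eps, eps > 0 -> exists N, forall n, (n >= N)%nat -> Cmod (u n - q)%C < eps.

Definition Rdiverges (u : nat -> R) : Prop :=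
  forall M, exists N, forall n, (n >= N)%nat -> u n > M.

(** The height of [F_n(j)] is [1 / (|c|^2 + |d|^2)], and its horizontal part differs from [F_n(0)]
    by [|c| / |d|] times that height, where [|c| < |d|]. Ideal convergence thus reduces to the orbit
    of [0] and the growth of [|d|]. *)
Lemma Fext_jpt (f : nat -> Mob) (n : nat) : (forall n, unit_MD (f n)) ->
  exists (z : C) (t : R), Fext f n jpt = (z, t) /\ 0 < t <= / Cmod (cd (prodmob f n)) ^ 2 /\
    Cmod (z - ev (prodmob f n) 0)%C <= t.
Proof.
  intros Hf; unfold jpt; change C0 with (RtoC 0); rewrite Fext_prodmob by (auto; lra).
  destruct (prodmob_bounds f n Hf) as (H1 & Hm & _).
  set (g := prodmob f n) in *.
  assert (Hd : Cmod (cc g) < Cmod (cd g)) by (apply mm_pos_Cmod_lt; lra).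
  pose proof (Cmod_ge_0 (cc g)) as c0.
  assert (Hd0 : cd g <> 0%C) by (apply Cmod_neq0; lra).
  rewrite mob_ext_C.
  assert (EN : extden g 0 1 = Cmod (cd g) ^ 2 + Cmod (cc g) ^ 2).
  { unfold extden, den; replace (cc g * 0 + cd g)%C with (cd g) by ring; ring. }
  pose proof (RtoC_extden g 0 1) as ENC.
  set (N := extden g 0 1) in *.
  assert (Hdd : 0 < Cmod (cd g) ^ 2) by (apply pow_lt; lra).
  assert (HN : 0 < N) by (rewrite EN; nra).
  assert (HNC : RtoC N <> 0%C) by (apply RtoC_neq0; lra).
  rewrite H1; eexists; eexists; split; [reflexivity|split; [split|]].
  - apply Rdiv_lt_0_compat; lra.
  - unfold Rdiv; rewrite !Rmult_1_l; apply Rinv_le_contravar; auto. rewrite EN; nra.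
  - match goal with |- Cmod (?x - _)%C <= _ =>
      replace (x - ev g 0)%C with (cdet g * Cconj (cc g) / (cd g * RtoC N))%C end.
    + rewrite Cmod_div, !Cmod_mult, Cmod_conj, H1, Cmod_R, Rabs_pos_eq by
        (try apply Cmult_neq_0; auto; lra).
      replace (1 * Cmod (cc g) / (Cmod (cd g) * N)) with (Cmod (cc g) / Cmod (cd g) * (1 / N))
        by (field; lra).
      rewrite <- (Rmult_1_l (1 * 1 / N)).
      rewrite Rmult_1_l at 1.
      apply Rmult_le_compat; try lra.
      * apply Rdiv_le_0_compat; lra.
      * apply Rdiv_le_0_compat; lra.
      * apply Rle_div_l; lra.
    + symmetry.
      transitivity ((((ca g * 0 + cb g) * Cconj (den g 0) + RtoC (1 ^ 2) * (ca g * Cconj (cc g))) * cd g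
         - cb g * RtoC N) / (cd g * RtoC N))%C.
      * unfold ev, den at 2; replace (cc g * 0 + cd g)%C with (cd g) by ring.
        field; auto.
      * f_equal; rewrite ENC; unfold den, cdet.
        replace (cc g * 0 + cd g)%C with (cd g) by ring.
        replace (RtoC (1 ^ 2)) with (RtoC 1) by (f_equal; ring). ring.
Qed.

Lemma converges_ideally_of_orbit (f : nat -> Mob) (q : C) : (forall n, unit_MD (f n)) ->
  Ctends (fun n => ev (prodmob f n) 0) q -> Rdiverges (fun n => Cmod (cd (prodmob f n)) ^ 2) ->
  converges_ideally f q.
Proof.
  intros Hf Hq Hd.
  assert (Hsmall : forall e, 0 < e -> exists N, forall n, (n >= N)%nat ->
     exists (z : C) (t : R), Fext f n jpt = (z, t) /\ 0 < t < e /\ Cmod (z - q)%C < e).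
  { intros e He.
    destruct (Hq (e / 2)) as [N1 H1]; [lra|].
    destruct (Hd (2 / e)) as [N2 H2].
    exists (max N1 N2); intros n Hn.
    specialize (H1 n ltac:(lia)); specialize (H2 n ltac:(lia)); cbv beta in *.
    destruct (Fext_jpt f n Hf) as (z & t & E & [Ht1 Ht2] & Hz).
    assert (0 < 2 / e) by (apply Rdiv_lt_0_compat; lra).
    assert (/ Cmod (cd (prodmob f n)) ^ 2 < e / 2).
    { replace (e / 2) with (/ (2 / e)) by (field; lra). apply Rinv_lt_contravar; nra. }
    exists z, t; repeat split; auto; try lra.
    pose proof (Cmod_minus_triangle z (ev (prodmob f n) 0) q); lra. }
  split.
  - intros M.
    (* A height [t < e] has [(1 - t)^2 >= 1/4] and [t * exp M <= 1/8], so [cosh rho > exp M]; then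
       [arcosh x >= ln x] suffices. *)
    set (e := Rmin (1 / 2) (/ (8 * exp M))).
    pose proof (exp_pos M) as HM.
    assert (He : 0 < e).
    { unfold e; apply Rmin_pos; [lra | apply Rinv_0_lt_compat; lra]. }
    destruct (Hsmall e He) as [N HN]; exists N; intros n Hn.
    destruct (HN n Hn) as (z & t & E & [Ht1 Ht2] & _).
    rewrite E; unfold rho, arcosh, jpt, eucl2_H3; cbn [fst snd].
    rewrite Cnorm2_Cmod.
    pose proof (Rmin_l (1 / 2) (/ (8 * exp M))); pose proof (Rmin_r (1 / 2) (/ (8 * exp M))).
    fold e in H, H0.
    set (w := Cmod (Csub C0 z) ^ 2); assert (Hw : 0 <= w) by apply pow2_ge_0.
    set (x := 1 + (w + (1 - t) * (1 - t)) / (2 * 1 * t)).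
    pose proof (sqrt_pos (x * x - 1)).
    assert (exp M < x).
    { assert (exp M <= (w + (1 - t) * (1 - t)) / (2 * 1 * t)); [|unfold x; lra].
      apply Rle_div_r; [lra|].
      assert (t * exp M <= 1 / 8).
      { replace (1 / 8) with (/ (8 * exp M) * exp M) by (field; lra).
        apply Rmult_le_compat_r; lra. }
      assert (1 / 4 <= (1 - t) * (1 - t)) by nra. nra. }
    rewrite <- (ln_exp M); apply ln_increasing; lra.
  - intros eps Heps.
    destruct (Hsmall (eps / 4)) as [N HN]; [lra|]; exists N; intros n Hn.
    destruct (HN n Hn) as (z & t & E & [Ht1 Ht2] & Hz).
    rewrite E; unfold chordal3, eucl2_H3; cbn [fst snd].
    change (Csub z q) with (z - q)%C; rewrite !Cnorm2_Cmod.
    assert (Hs : sqrt (Cmod (z - q)%C ^ 2 + (t - 0) * (t - 0)) < eps / 2).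
    { rewrite <- (sqrt_pow2 (eps / 2)) by lra.
      pose proof (Cmod_ge_0 (z - q)).
      apply sqrt_lt_1_alt; split; nra. }
    assert (Hden : 1 <= sqrt ((1 + Cmod z ^ 2 + t * t) * (1 + Cmod q ^ 2))).
    { apply Rle_trans with (sqrt (1 * 1)); [rewrite Rmult_1_l, sqrt_1; lra|].
      apply sqrt_le_1_alt.
      pose proof (pow2_ge_0 (Cmod z)); pose proof (pow2_ge_0 (Cmod q)).
      pose proof (Rle_0_sqr t); unfold Rsqr in *; apply Rmult_le_compat; lra. }
    apply Rlt_div_l; [lra|]. nra.
Qed.

(** * Limits of sequences *)

(** Finiteness of the collection of generators enters the proof through this lemma, which gives a
    common constant for any upward closed condition. *)
Lemma list_upper_bound {A : Type} (l : list A) (Q : A -> R -> Prop) :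
  (forall a x y, Q a x -> x <= y -> Q a y) -> (forall a, In a l -> exists x, Q a x) ->
  exists x, 1 <= x /\ forall a, In a l -> Q a x.
Proof.
  intros Hmon; induction l as [|a l IH]; intros Hex.
  - exists 1; split; [lra | intros a []].
  - destruct IH as (x & Hx & Hl); [intros b Hb; apply Hex; right; auto|].
    destruct (Hex a) as [y Hy]; [left; auto|].
    exists (Rmax x y); pose proof (Rmax_l x y); pose proof (Rmax_r x y).
    split; [lra|]; intros b [->|Hb]; eauto.
Qed.

Lemma Ctends_of_Cauchy (u : nat -> C) :
  (forall eps, eps > 0 -> exists N, forall n l, (n >= N)%nat -> (l >= n)%nat ->
     Cmod (u l - u n)%C < eps) ->
  exists q, Ctends u q.
Proof.
  intros H.
  assert (Hc : forall p : C -> R, (forall z w, Rabs (p z - p w) <= Cmod (z - w)%C) ->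
     {l | Un_cv (fun n => p (u n)) l}).
  { intros p Hp; apply Rcomplete.R_complete; intros eps Heps.
    destruct (H eps Heps) as [N HN]; exists N; intros n k Hn Hk; unfold Rdist.
    destruct (Nat.le_ge_cases n k).
    - rewrite Rabs_minus_sym; eapply Rle_lt_trans; [apply Hp | apply HN; lia].
    - eapply Rle_lt_trans; [apply Hp | apply HN; lia]. }
  assert (Hfst : forall z w : C, Rabs (fst z - fst w) <= Cmod (z - w)%C /\ Rabs (snd z - snd w) <= Cmod (z - w)%C).
  { intros z w; pose proof (Rmax_Cmod (z - w)%C) as Hm; unfold Cminus, Cplus, Copp in *; simpl in *.
    split; eapply Rle_trans; [|exact Hm| |exact Hm]; [apply Rmax_l | apply Rmax_r]. }
  destruct (Hc fst) as [x Hx]; [intros; apply Hfst|].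
  destruct (Hc snd) as [y Hy]; [intros; apply Hfst|].
  exists (x, y); intros eps Heps.
  destruct (Hx (eps / 2)) as [N1 H1]; [lra|]; destruct (Hy (eps / 2)) as [N2 H2]; [lra|].
  exists (max N1 N2); intros n Hn.
  specialize (H1 n ltac:(lia)); specialize (H2 n ltac:(lia)); unfold Rdist in *.
  eapply Rle_lt_trans; [apply Cmod_2Rmax|]; simpl.
  fold (fst (u n) - x); fold (snd (u n) - y).
  assert (Hmx : Rmax (Rabs (fst (u n) - x)) (Rabs (snd (u n) - y)) < eps / 2) by (apply Rmax_lub_lt; auto).
  pose proof (sqrt_pos 2); assert (sqrt 2 < 2).
  { apply Rlt_le_trans with (sqrt (2 ^ 2)); [apply sqrt_lt_1_alt | rewrite sqrt_pow2]; lra. }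
  pose proof (Rmax_l (Rabs (fst (u n) - x)) (Rabs (snd (u n) - y))).
  pose proof (Rabs_pos (fst (u n) - x)).
  change (snd (u n) + - y) with (snd (u n) - y); change (fst (u n) + - x) with (fst (u n) - x).
  nra.
Qed.

Lemma Ctends_closed_disc (u : nat -> C) (q k : C) (r : R) (N : nat) :
  Ctends u q -> (forall n, (n >= N)%nat -> Cmod (u n - k)%C <= r) -> Cmod (q - k)%C <= r.
Proof.
  intros Hq H; destruct (Rle_lt_dec (Cmod (q - k)%C) r) as [|Hlt]; auto; exfalso.
  destruct (Hq (Cmod (q - k)%C - r)) as [N' HN]; [lra|].
  specialize (HN (max N N') ltac:(lia)); specialize (H (max N N') ltac:(lia)).
  pose proof (Cmod_minus_triangle q (u (max N N')) k).
  rewrite (Cmod_minus_sym q (u _)) in H0; lra.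
Qed.

(** * Uniform constants *)

(** The increment of [|d|^2 - |c|^2] when the row [(c, d)] is multiplied by the matrix of [g]; for
    the bottom row of [F_n] it is the increment of [m_n]. *)
Definition growth (g : Mob) (c d : C) : R :=
  Cmod (c * cb g + d * cd g)%C ^ 2 - Cmod (c * ca g + d * cc g)%C ^ 2 - (Cmod d ^ 2 - Cmod c ^ 2).

(** A single constant for all estimates on one generator. The third clause keeps [g(0)] away from
    the unit circle, for the step of the orbit of [0]; the last two control the passage of the row
    across the tangency point [alp g]. The condition is upward closed in [K] because the growth is
    non-negative. *)
Definition gen_bound (g : Mob) (K : R) : Prop :=
  (touching g -> forall c d, Cmod c <= Cmod d -> Cmod (c * bet g + d)%C ^ 2 <= K * growth g c d) /\
  (~ touching g -> forall c d, Cmod c <= Cmod d -> Cmod d ^ 2 <= K * growth g c d) /\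
  1 <= K * (1 - Cmod (ev g 0)) /\
  Cmod (den g (alp g)) <= K /\
  Cmod (den g (alp g)) * Cmod (cb g) <= K.

Lemma unit_MD_gen_bound (g : Mob) : unit_MD g -> exists K, gen_bound g K.
Proof.
  intros Hg.
  assert (H0 : Cmod (ev g 0) < 1).
  { apply (in_MD_ev g (proj1 Hg)); rewrite Cmod_0; lra. }
  pose proof (unit_MD_disc_bounds g Hg) as [_ Hm].
  assert (HK1 : exists K1, 0 < K1 /\
    (touching g -> forall c d, Cmod c <= Cmod d -> Cmod (c * bet g + d)%C ^ 2 <= K1 * growth g c d) /\
    (~ touching g -> forall c d, Cmod c <= Cmod d -> Cmod d ^ 2 <= K1 * growth g c d)).
  { destruct (classic (touching g)) as [Ht|Ht].
    - exists (/ (mm g - 1)); split; [apply Rinv_0_lt_compat; lra|]; split; [|tauto].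
      intros _ c d _; unfold growth; rewrite touching_row_growth by auto.
      apply Req_le; field; lra.
    - destruct (nontouching_row_growth g Hg Ht) as (K1 & HK & H1).
      exists K1; split; auto; split; [tauto | intros _; exact H1]. }
  destruct HK1 as (K1 & HK1 & Ha & Hb).
  set (D := Cmod (den g (alp g))); assert (D0 : 0 <= D) by apply Cmod_ge_0.
  pose proof (Cmod_ge_0 (cb g)) as b0.
  set (s := / (1 - Cmod (ev g 0))).
  assert (Hs : 0 < s) by (apply Rinv_0_lt_compat; lra).
  assert (Hs1 : s * (1 - Cmod (ev g 0)) = 1) by (unfold s; field; lra).
  assert (0 <= D * Cmod (cb g)) by nra.
  exists (K1 + s + D + D * Cmod (cb g)).
  split; [|split; [|split; [|split]]].
  - intros Ht c d Hcd; pose proof (row_growth_nonneg g c d Hg Hcd) as Hn; fold (growth g c d) in Hn.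
    eapply Rle_trans; [apply (Ha Ht c d Hcd) | apply Rmult_le_compat_r; lra].
  - intros Ht c d Hcd; pose proof (row_growth_nonneg g c d Hg Hcd) as Hn; fold (growth g c d) in Hn.
    eapply Rle_trans; [apply (Hb Ht c d Hcd) | apply Rmult_le_compat_r; lra].
  - nra.
  - fold D; lra.
  - fold D; lra.
Qed.

Lemma gen_bound_mono (g : Mob) (K L : R) : unit_MD g -> gen_bound g K -> K <= L -> gen_bound g L.
Proof.
  intros Hg (Ha & Hb & Hc & Hd & He) HKL.
  assert (H0 : Cmod (ev g 0) <= 1) by (apply unit_MD_ev_le1; auto; rewrite Cmod_0; lra).
  split; [|split; [|split; [|split]]]; try lra.
  - intros Ht c d Hcd; pose proof (row_growth_nonneg g c d Hg Hcd) as Hn; fold (growth g c d) in Hn.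
    eapply Rle_trans; [apply (Ha Ht c d Hcd) | apply Rmult_le_compat_r; lra].
  - intros Ht c d Hcd; pose proof (row_growth_nonneg g c d Hg Hcd) as Hn; fold (growth g c d) in Hn.
    eapply Rle_trans; [apply (Hb Ht c d Hcd) | apply Rmult_le_compat_r; lra].
  - nra.
Qed.

(** * Composition sequences *)

Section Sequence.
Variable f : nat -> Mob.
Hypothesis Hf : forall n, unit_MD (f n).

Let P (n : nat) : Mob := prodmob f n.
Let c (n : nat) : C := cc (P n).
Let d (n : nat) : C := cd (P n).
Let m (n : nat) : R := mm (P n).

Lemma seq_det (n : nat) : Cmod (cdet (P n)) = 1.
Proof. apply prodmob_bounds; auto. Qed.

Lemma seq_m_ge1 (n : nat) : 1 <= m n.
Proof. apply prodmob_bounds; auto. Qed.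

Lemma seq_m_mono (n l : nat) : (n <= l)%nat -> m n <= m l.
Proof.
  induction 1; [lra|]; destruct (prodmob_bounds f m0 Hf) as (_ & _ & H1).
  unfold m, P in *; lra.
Qed.

Lemma seq_cd (n : nat) : Cmod (c n) < Cmod (d n) /\ 1 <= Cmod (d n) /\ m n <= Cmod (d n) ^ 2.
Proof.
  pose proof (seq_m_ge1 n) as H.
  assert (Cmod (c n) < Cmod (d n)) by (apply mm_pos_Cmod_lt; unfold m in H; lra).
  assert (m n = Cmod (d n) ^ 2 - Cmod (c n) ^ 2) by reflexivity.
  pose proof (Cmod_ge_0 (c n)); pose proof (pow2_ge_0 (Cmod (c n))).
  repeat split; auto; [nra|lra].
Qed.

Lemma seq_den_neq0 (n : nat) (w : C) : Cmod w <= 1 -> den (P n) w <> 0%C.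
Proof. intros; apply den_neq0; auto; pose proof (seq_m_ge1 n); unfold m in *; lra. Qed.

Lemma seq_image_disc (n : nat) (w : C) : Cmod w <= 1 ->
  Cmod (ev (P n) w - kap (P n))%C <= / m n.
Proof.
  intros; apply ev_in_image_disc; auto; [apply seq_det|].
  pose proof (seq_m_ge1 n); unfold m in *; lra.
Qed.

Lemma Fcomp_nested (n l : nat) (w : C) : (n <= l)%nat -> Cmod w <= 1 ->
  exists w', Cmod w' <= 1 /\ Fcomp f l w = Fcomp f n w'.
Proof.
  intros Hnl; revert w; induction Hnl as [|l Hnl IH]; intros w Hw.
  - exists w; auto.
  - cbn [Fcomp]; apply IH; rewrite mob_eval_ev; apply unit_MD_ev_le1; auto.
Qed.

Lemma seq_nested_disc (n l : nat) (w : C) : (n <= l)%nat -> Cmod w <= 1 ->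
  Cmod (ev (P l) w - kap (P n))%C <= / m n.
Proof.
  intros Hnl Hw; destruct (Fcomp_nested n l w Hnl Hw) as (w' & Hw' & E).
  rewrite !Fcomp_prodmob in E by auto; unfold P at 1; rewrite E; apply seq_image_disc; auto.
Qed.

Lemma seq_surj (n : nat) (y : C) : Cmod (y - kap (P n))%C <= / m n ->
  exists w : C, Cmod w <= 1 /\ Fcomp f n w = y.
Proof.
  intros Hy; exists (evinv (P n) y).
  assert (Hm : 0 < mm (P n)) by (pose proof (seq_m_ge1 n); unfold m in *; lra).
  destruct (evinv_cldisc (P n) y (seq_det n) Hm Hy) as [Hle _].
  split; auto; rewrite Fcomp_prodmob by auto.
  apply evinv_spec; auto; apply seq_det.
Qed.

(** The closed image discs are nested, so each of them contains a tail of the orbit of [0] and hence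
    its limit. *)
Lemma seq_limit_in_images (q : C) : Ctends (fun n => ev (P n) 0) q ->
  forall n, exists w : C, Cmod w <= 1 /\ Fcomp f n w = q.
Proof.
  intros Hq n; apply seq_surj.
  apply (Ctends_closed_disc _ q _ _ n Hq).
  intros l Hl; apply seq_nested_disc; auto; rewrite Cmod_0; lra.
Qed.

Lemma seq_limit_cldisc (q : C) : Ctends (fun n => ev (P n) 0) q -> Cmod q <= 1.
Proof.
  intros Hq; destruct (seq_limit_in_images q Hq 0) as (w & Hw & <-); exact Hw.
Qed.

(** The radii [/ m n] of the nested discs tend to zero, and two points of the [n]-th disc are at
    most [2 / m n] apart. This yields the Cauchy property, uniform convergence and the one-point
    intersection together; ideal convergence follows from [m n <= |d n|^2]. *)
Lemma unbounded_limit_point : (forall M, exists n, m n > M) ->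
  exists q, Cmod q <= 1 /\ converges_ideally f q /\
    (forall eps, eps > 0 -> exists N, forall n w, (n >= N)%nat -> Cmod w <= 1 ->
       Cmod (Fcomp f n w - q)%C < eps) /\
    limit_point_type f.
Proof.
  intros Hm.
  assert (Hm' : forall e, e > 0 -> exists N, forall n, (n >= N)%nat -> / m n < e).
  { intros e He; destruct (Hm (/ e)) as [N HN]; exists N; intros n Hn.
    pose proof (seq_m_mono N n Hn); pose proof (Rinv_0_lt_compat e He).
    rewrite <- (Rinv_inv e); apply Rinv_lt_contravar; nra. }
  destruct (Ctends_of_Cauchy (fun n => ev (P n) 0)) as [q Hq].
  { intros e He; destruct (Hm' (e / 2)) as [N HN]; [lra|]; exists N; intros n l Hn Hl.
    specialize (HN n Hn).
    assert (H0 : Cmod 0 <= 1) by (rewrite Cmod_0; lra).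
    pose proof (seq_nested_disc n l 0 Hl H0); pose proof (seq_image_disc n 0 H0) as H2.
    pose proof (Cmod_minus_triangle (ev (P l) 0) (kap (P n)) (ev (P n) 0)).
    rewrite Cmod_minus_sym in H2; lra. }
  pose proof (seq_limit_in_images q Hq) as Him.
  assert (Hqk : forall n, Cmod (q - kap (P n))%C <= / m n).
  { intros n; destruct (Him n) as (w & Hw & <-); rewrite Fcomp_prodmob by auto.
    apply seq_image_disc; auto. }
  assert (Hunif : forall n w, Cmod w <= 1 -> Cmod (Fcomp f n w - q)%C <= 2 * / m n).
  { intros n w Hw; rewrite Fcomp_prodmob by auto; fold (P n).
    pose proof (seq_image_disc n w Hw); pose proof (Hqk n) as H2.
    pose proof (Cmod_minus_triangle (ev (P n) w) (kap (P n)) q).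
    rewrite Cmod_minus_sym in H2; lra. }
  exists q; split; [|split; [|split]].
  - apply seq_limit_cldisc; auto.
  - apply converges_ideally_of_orbit; auto.
    intros M; destruct (Hm M) as [N HN]; exists N; intros n Hn.
    pose proof (seq_m_mono N n Hn); destruct (seq_cd n) as (_ & _ & H1); unfold d, P in *; lra.
  - intros e He; destruct (Hm' (e / 2)) as [N HN]; [lra|]; exists N; intros n w Hn Hw.
    specialize (HN n Hn); specialize (Hunif n w Hw); lra.
  - exists q; intros z; split.
    + intros Hz.
      assert (Hzq : Cmod (z - q)%C <= 0).
      { destruct (Rle_lt_dec (Cmod (z - q)%C) 0) as [|Hlt]; auto; exfalso.
        destruct (Hm' (Cmod (z - q)%C / 2)) as [N HN]; [lra|]; specialize (HN N (le_n N)).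
        destruct (Hz N) as (w & Hw & E); unfold in_cldisc in Hw; rewrite Cnorm_Cmod in Hw.
        specialize (Hunif N w Hw); rewrite E in Hunif; lra. }
      apply Cmod_minus_le0; auto.
    + intros -> n; destruct (Him n) as (w & Hw & E); exists w; split; auto.
      unfold in_cldisc; rewrite Cnorm_Cmod; auto.
Qed.

(** * The case of bounded [m n], where the discs do not shrink to a point *)

Variables (K L M : R).
Hypothesis HK1 : 1 <= K.
Hypothesis HK : forall n, gen_bound (f n) K.
Hypothesis HL : forall n k, alp (f n) <> bet (f k) -> 1 <= L * Cmod (alp (f n) - bet (f k))%C.
Hypothesis HM : forall n, m n <= M.

(** With generators indexed from zero, [f n] is the factor that turns [P n] into [P (S n)]. So [E n]
    is the denominator of [F_n] at the tangency point of the next generator. *)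
Let E (n : nat) : C := den (P n) (bet (f n)).
Let al (n : nat) : C := alp (f n).

Lemma seq_growth (n : nat) : growth (f n) (c n) (d n) = m (S n) - m n.
Proof. reflexivity. Qed.

Lemma bounded_m_Cauchy (e : R) : e > 0 ->
  exists N, forall n l, (n >= N)%nat -> (l >= n)%nat -> m l - m n < e.
Proof.
  intros He.
  assert (Hcv : {l | Un_cv m l}).
  { apply growing_cv; [intros n; apply seq_m_mono; lia|].
    exists M; intros x [n ->]; auto. }
  destruct (CV_Cauchy m Hcv e He) as [N HN]; exists N; intros n l Hn Hl.
  specialize (HN l n ltac:(lia) ltac:(lia)); unfold Rdist in HN.
  pose proof (Rle_abs (m l - m n)); lra.
Qed.

(** Since [|d n| >= 1], each generator that is not tangent adds at least [/ K] to the bounded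
    sequence [m]. *)
Lemma eventually_touching : exists N, forall n, (n >= N)%nat -> touching (f n).
Proof.
  destruct (bounded_m_Cauchy (/ K)) as [N HN]; [apply Rinv_0_lt_compat; lra|].
  exists N; intros n Hn; destruct (classic (touching (f n))) as [|Ht]; auto; exfalso.
  destruct (HK n) as (_ & Hb & _); destruct (seq_cd n) as (H1 & H2 & _).
  specialize (Hb Ht (c n) (d n) ltac:(lra)); rewrite seq_growth in Hb.
  specialize (HN n (S n) Hn ltac:(lia)).
  assert (K * (m (S n) - m n) < 1).
  { replace 1 with (K * / K) by (field; lra). apply Rmult_lt_compat_l; lra. }
  nra.
Qed.

Lemma E_sqr_le (n : nat) : touching (f n) -> Cmod (E n) ^ 2 <= K * (m (S n) - m n).
Proof.
  intros Ht; rewrite <- seq_growth; destruct (HK n) as (Ha & _); destruct (seq_cd n) as (H1 & _).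
  apply (Ha Ht); lra.
Qed.

(** Because [|bet (f n)| = 1], [|E n| >= |d| - |c| = m / (|d| + |c|)], with [m >= 1] and
    [|c| < |d|]. *)
Lemma E_lower (n : nat) : touching (f n) -> 1 <= 2 * (Cmod (E n) * Cmod (d n)).
Proof.
  intros Ht; destruct (touching_bet (f n) (Hf n) Ht) as [Hb _]; destruct (seq_cd n) as (H1 & H2 & _).
  pose proof (Cmod_reverse_triangle (d n) (c n * bet (f n))) as Hr.
  rewrite Cplus_comm, Cmod_mult, Hb in Hr; change (c n * bet (f n) + d n)%C with (E n) in Hr.
  pose proof (seq_m_ge1 n) as Hm; change (m n) with (Cmod (d n) ^ 2 - Cmod (c n) ^ 2) in Hm.
  pose proof (Cmod_ge_0 (c n)).
  assert ((Cmod (d n) - Cmod (c n)) * (Cmod (d n) + Cmod (c n)) <= Cmod (E n) * (2 * Cmod (d n))).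
  { apply Rmult_le_compat; lra. }
  nra.
Qed.

Lemma E_tends (e : R) : e > 0 -> exists N, forall n, (n >= N)%nat -> Cmod (E n) < e.
Proof.
  intros He; destruct eventually_touching as [N1 H1].
  destruct (bounded_m_Cauchy (e ^ 2 / K)) as [N2 H2].
  { apply Rdiv_lt_0_compat; [apply pow_lt|]; lra. }
  exists (max N1 N2); intros n Hn.
  pose proof (E_sqr_le n (H1 n ltac:(lia))) as HE; specialize (H2 n (S n) ltac:(lia) ltac:(lia)).
  assert (K * (m (S n) - m n) < e ^ 2).
  { replace (e ^ 2) with (K * (e ^ 2 / K)) by (field; lra). apply Rmult_lt_compat_l; lra. }
  pose proof (Cmod_ge_0 (E n)); nra.
Qed.

(** The product [|E n| * |d n|] stays at least [1/2] while [E n] tends to zero. *)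
Lemma d_diverges : Rdiverges (fun n => Cmod (d n) ^ 2).
Proof.
  intros B; destruct eventually_touching as [N1 H1].
  (* This threshold forces [|d n| >= |B| + 1], whose square exceeds [B]. *)
  destruct (E_tends (/ (2 * (Rabs B + 1)))) as [N2 H2].
  { apply Rinv_0_lt_compat; pose proof (Rabs_pos B); lra. }
  exists (max N1 N2); intros n Hn.
  pose proof (E_lower n (H1 n ltac:(lia))) as Hl; specialize (H2 n ltac:(lia)).
  pose proof (Rabs_pos B); pose proof (Rle_abs B); destruct (seq_cd n) as (_ & Hd & _).
  assert (Cmod (E n) * Cmod (d n) <= / (2 * (Rabs B + 1)) * Cmod (d n)).
  { apply Rmult_le_compat_r; lra. }
  assert (Rabs B + 1 <= Cmod (d n)).
  { apply Rmult_le_reg_l with (2 * / (2 * (Rabs B + 1))).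
    - apply Rmult_lt_0_compat; [lra | apply Rinv_0_lt_compat; lra].
    - replace (2 * / (2 * (Rabs B + 1)) * (Rabs B + 1)) with 1 by (field; lra). lra. }
  nra.
Qed.

Lemma ev_minus_ev0 (n : nat) (w : C) : Cmod w <= 1 ->
  Cmod (ev (P n) w - ev (P n) 0)%C = Cmod w / (Cmod (den (P n) w) * Cmod (d n)).
Proof.
  intros Hw; pose proof (seq_den_neq0 n w Hw) as Hd.
  assert (Hd0 : cd (P n) <> 0%C) by (apply Cmod_neq0; destruct (seq_cd n) as (_ & H & _); unfold d in H; lra).
  replace (ev (P n) w - ev (P n) 0)%C with (cdet (P n) * w / (den (P n) w * cd (P n)))%C.
  - rewrite Cmod_div, !Cmod_mult, seq_det by (apply Cmult_neq_0; auto). unfold d; f_equal; ring.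
  - unfold ev, cdet, den in *; field; auto.
Qed.

(** Here [F_{n+1}(0) = F_n(w)] with [w = f_n(0)], and [1 - |w| >= / K] gives [|c w + d| >= |d| / K].
    The step is therefore at most [K / |d|^2], and [1 / |d|^2 <= 4 * |E n|^2]. *)
Lemma orbit_step (n : nat) : touching (f n) ->
  Cmod (ev (P (S n)) 0 - ev (P n) 0)%C <= 4 * K ^ 2 * (m (S n) - m n).
Proof.
  intros Ht.
  assert (H0 : Cmod 0 <= 1) by (rewrite Cmod_0; lra).
  set (w := ev (f n) 0); pose proof (unit_MD_ev_le1 (f n) 0 (Hf n) H0) as Hw; fold w in Hw.
  destruct (HK n) as (_ & _ & Hw1 & _); fold w in Hw1.
  assert (Eq : ev (P (S n)) 0 = ev (P n) w).
  { unfold P; cbn [prodmob]; apply ev_mobmul.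
    - apply unit_MD_ev_cldisc; auto.
    - apply seq_den_neq0; auto. }
  rewrite Eq, ev_minus_ev0 by auto.
  destruct (seq_cd n) as (Hcd & Hd & _).
  pose proof (Cmod_reverse_triangle (d n) (c n * w)) as Hr.
  rewrite Cplus_comm, Cmod_mult in Hr.
  change (c n * w + d n)%C with (den (P n) w) in Hr.
  pose proof (Cmod_ge_0 w) as w0; pose proof (Cmod_ge_0 (c n)) as c0.
  assert (Hden : Cmod (d n) <= K * Cmod (den (P n) w)).
  { assert (Cmod (d n) * (1 - Cmod w) <= Cmod (den (P n) w)) by nra.
    assert (K * (Cmod (d n) * (1 - Cmod w)) <= K * Cmod (den (P n) w)) by (apply Rmult_le_compat_l; lra).
    nra. }
  assert (Hdp : 0 < Cmod (den (P n) w)) by (apply Cmod_pos, seq_den_neq0; auto).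
  pose proof (E_lower n Ht) as Hl; pose proof (E_sqr_le n Ht) as Hs.
  apply Rle_div_l; [nra|].
  assert (H1 : 1 <= 4 * (Cmod (E n) ^ 2 * Cmod (d n) ^ 2)).
  { replace (4 * (Cmod (E n) ^ 2 * Cmod (d n) ^ 2)) with ((2 * (Cmod (E n) * Cmod (d n))) ^ 2) by ring.
    rewrite <- (pow1 2); apply pow_incr; lra. }
  set (v := m (S n) - m n) in *.
  assert (Hv : 0 <= v) by (pose proof (seq_m_mono n (S n) ltac:(lia)); unfold v; lra).
  assert (H2 : 1 <= 4 * (K * v * Cmod (d n) ^ 2)).
  { eapply Rle_trans; [exact H1|].
    apply Rmult_le_compat_l; [lra|]; apply Rmult_le_compat_r; [apply pow2_ge_0|auto]. }
  assert (H3 : K * v * Cmod (d n) ^ 2 <= K * v * (K * Cmod (den (P n) w) * Cmod (d n))).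
  { apply Rmult_le_compat_l; [nra|]. nra. }
  replace (4 * K ^ 2 * v * (Cmod (den (P n) w) * Cmod (d n)))
    with (4 * (K * v * (K * Cmod (den (P n) w) * Cmod (d n)))) by ring.
  lra.
Qed.

Lemma orbit_converges : exists q, Ctends (fun n => ev (P n) 0) q.
Proof.
  destruct eventually_touching as [N1 H1].
  apply Ctends_of_Cauchy; intros e He.
  destruct (bounded_m_Cauchy (e / (4 * K ^ 2))) as [N2 H2].
  { apply Rdiv_lt_0_compat; nra. }
  exists (max N1 N2); intros n l Hn Hl.
  assert (Hsum : Cmod (ev (P l) 0 - ev (P n) 0)%C <= 4 * K ^ 2 * (m l - m n)).
  { induction Hl as [|l Hl IH].
    - replace (ev (P n) 0 - ev (P n) 0)%C with (RtoC 0) by ring. rewrite Cmod_0; lra.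
    - pose proof (orbit_step l (H1 l ltac:(lia))).
      pose proof (Cmod_minus_triangle (ev (P (S l)) 0) (ev (P l) 0) (ev (P n) 0)). lra. }
  specialize (H2 n l ltac:(lia) Hl).
  assert (4 * K ^ 2 * (m l - m n) < e); [|lra].
  replace e with (4 * K ^ 2 * (e / (4 * K ^ 2))) by (field; lra).
  apply Rmult_lt_compat_l; nra.
Qed.

Lemma den_al (n : nat) : touching (f n) -> den (P (S n)) (al n) = (E n * den (f n) (al n))%C.
Proof.
  intros Ht; destruct (touching_alp (f n) (Hf n) Ht) as (_ & Hd & Hev).
  unfold P; cbn [prodmob]; rewrite den_mobmul by auto.
  unfold al; rewrite Hev; reflexivity.
Qed.

(** Dividing by [|c (S n)|], which diverges, shows that the pole of [F_{n+1}] approaches [al n]. *)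
Lemma den_al_le (n : nat) : touching (f n) -> Cmod (den (P (S n)) (al n)) <= K * Cmod (E n).
Proof.
  intros Ht; rewrite den_al, Cmod_mult by auto; destruct (HK n) as (_ & _ & _ & Hd & _).
  fold (al n) in Hd; pose proof (Cmod_ge_0 (E n)); nra.
Qed.

Lemma c_diverges (B : R) : exists N, forall n, (n >= N)%nat -> Cmod (c n) > B.
Proof.
  destruct (d_diverges (M + B ^ 2)) as [N HN]; exists N; intros n Hn.
  specialize (HN n Hn); cbv beta in HN; specialize (HM n).
  change (m n) with (Cmod (d n) ^ 2 - Cmod (c n) ^ 2) in HM.
  pose proof (Cmod_ge_0 (c n)); nra.
Qed.

(** The denominator at [w] is [c * (w - al n)] plus the denominator at [al n]. The first term is
    large away from [al n] and the second is bounded by [K]. *)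
Lemma uniform_away_from_al (q : C) (r e : R) : Ctends (fun n => ev (P n) 0) q -> r > 0 -> e > 0 ->
  exists N, forall n w, (n >= N)%nat -> Cmod w <= 1 -> r <= Cmod (w - al n)%C ->
    Cmod (Fcomp f (S n) w - q)%C < e.
Proof.
  intros Hq Hr He.
  destruct eventually_touching as [N1 H1].
  destruct (E_tends 1) as [N2 H2]; [lra|].
  (* The first threshold makes the denominator at [w] at least one; the second, with [|c| < |d|],
     makes [1 / |d| < e / 2]. *)
  destruct (c_diverges (Rmax ((K + 1) / r) (2 / e))) as [N3 H3].
  destruct (Hq (e / 2)) as [N4 H4]; [lra|].
  exists (max (max N1 N2) (max N3 N4)); intros n w Hn Hw Hwr.
  rewrite Fcomp_prodmob by auto; fold (P (S n)).
  pose proof (den_al_le n (H1 n ltac:(lia))) as Hda.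
  specialize (H2 n ltac:(lia)); specialize (H3 (S n) ltac:(lia)); specialize (H4 (S n) ltac:(lia)).
  cbv beta in H4.
  pose proof (Rmax_l ((K + 1) / r) (2 / e)); pose proof (Rmax_r ((K + 1) / r) (2 / e)).
  assert (Hc : K + 1 < Cmod (c (S n)) * r) by (apply Rlt_div_l; lra).
  assert (He' : 2 < Cmod (c (S n)) * e) by (apply Rlt_div_l; lra).
  assert (Hden : 1 <= Cmod (den (P (S n)) w)).
  { pose proof (Cmod_reverse_triangle (c (S n) * (w - al n)) (den (P (S n)) (al n))) as Ht.
    replace (c (S n) * (w - al n) + den (P (S n)) (al n))%C with (den (P (S n)) w) in Ht
      by (unfold den, c; ring).
    rewrite Cmod_mult in Ht; pose proof (Cmod_ge_0 (c (S n))); pose proof (Cmod_ge_0 (E n)).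
    assert (Cmod (c (S n)) * r <= Cmod (c (S n)) * Cmod (w - al n)%C) by (apply Rmult_le_compat_l; lra).
    nra. }
  destruct (seq_cd (S n)) as (Hcd & Hd & _).
  assert (Hw0 : Cmod (ev (P (S n)) w - ev (P (S n)) 0)%C < e / 2).
  { rewrite ev_minus_ev0 by auto.
    assert (1 < e / 2 * Cmod (d (S n))) by nra.
    apply Rlt_div_l; nra. }
  pose proof (Cmod_minus_triangle (ev (P (S n)) w) (ev (P (S n)) 0) q); lra.
Qed.

(** The denominator of [F_{n+1}] is at most [K] in modulus at [al n] and at most one at
    [bet (f (S n))]. The difference of the two values is [c * (al n - bet (f (S n)))], too large for
    distinct points separated by [/ L] once [|c| > L * (K + 1)]. *)
Lemma eventually_al_eq_bet : exists N, forall n, (n >= N)%nat ->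
  touching (f n) /\ al n = bet (f (S n)).
Proof.
  destruct eventually_touching as [N1 H1].
  destruct (E_tends 1) as [N2 H2]; [lra|].
  destruct (c_diverges (L * (K + 1))) as [N3 H3].
  exists (max N1 (max N2 N3)); intros n Hn.
  assert (Ht : touching (f n)) by (apply H1; lia); split; auto.
  destruct (classic (al n = bet (f (S n)))) as [|Hne]; auto; exfalso.
  pose proof (HL n (S n) Hne) as Hsep; fold (al n) in Hsep.
  pose proof (den_al_le n Ht) as Hda.
  pose proof (H2 n ltac:(lia)) as HE1; pose proof (H2 (S n) ltac:(lia)) as HE2.
  specialize (H3 (S n) ltac:(lia)).
  pose proof (Cmod_minus_triangle (den (P (S n)) (al n)) 0 (E (S n))) as Htr.
  replace (den (P (S n)) (al n) - E (S n))%C with (c (S n) * (al n - bet (f (S n))))%C in Htr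
    by (unfold E, den, c; ring).
  replace (den (P (S n)) (al n) - 0)%C with (den (P (S n)) (al n)) in Htr by ring.
  replace (0 - E (S n))%C with (- E (S n))%C in Htr by ring.
  rewrite Cmod_opp, Cmod_mult in Htr.
  set (x := Cmod (al n - bet (f (S n)))%C) in *.
  assert (Hx : 0 < x) by (pose proof (Cmod_ge_0 (al n - bet (f (S n)))%C) as H0; fold x in H0; nra).
  assert (Cmod (c (S n)) * x < K + 1) by nra.
  assert (L * (K + 1) * x < K + 1) by nra.
  nra.
Qed.

(** The product [|E n| * |d n|] is the reciprocal distance from [F_n(bet (f n))] to [F_n(0)].
    Expanding the new row, the main term has exactly the old size, and the error is of order
    [|E n|^2], which the increment of [m] controls. *)
Lemma tangency_step (n : nat) : touching (f n) -> al n = bet (f (S n)) ->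
  Cmod (E (S n)) * Cmod (d (S n)) <= Cmod (E n) * Cmod (d n) + K ^ 2 * (m (S n) - m n).
Proof.
  intros Ht Hab.
  destruct (touching_alp (f n) (Hf n) Ht) as (Ha & Hda & Hev); fold (al n) in *.
  destruct (touching_bet (f n) (Hf n) Ht) as (Hb & _).
  assert (EE : E (S n) = (E n * den (f n) (al n))%C) by (rewrite <- den_al by auto; unfold E; rewrite Hab; auto).
  (* The new entry [c * cb + d * cd], times [bet (f n)], with [c * bet (f n)] replaced by
     [E n - d n]. *)
  assert (Hd : (bet (f n) * d (S n))%C = (cb (f n) * E n + d n * (cd (f n) * bet (f n) - cb (f n)))%C).
  { unfold d at 1, P; cbn [prodmob]; unfold E, den, d, mobmul, P; cbn.
    unfold cc, cd; cbn; ring. }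
  (* Its right side has modulus one, so the main term keeps its size. *)
  assert (Hinv : ((cd (f n) * bet (f n) - cb (f n)) * den (f n) (al n))%C = (cdet (f n) * al n)%C).
  { rewrite <- Hev; unfold ev, cdet, den in *; field; auto. }
  apply (f_equal Cmod) in Hinv; rewrite !Cmod_mult, (proj2 (Hf n)), Ha in Hinv.
  assert (Hd' : Cmod (d (S n)) <= Cmod (cb (f n)) * Cmod (E n)
       + Cmod (d n) * Cmod (cd (f n) * bet (f n) - cb (f n))%C).
  { rewrite <- !Cmod_mult, <- (Rmult_1_l (Cmod (d (S n)))), <- Hb, <- Cmod_mult, Hd. apply Cmod_triangle. }
  rewrite EE, Cmod_mult.
  destruct (HK n) as (_ & _ & _ & _ & HKb); fold (al n) in HKb.
  pose proof (E_sqr_le n Ht) as HE.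
  pose proof (Cmod_ge_0 (E n)) as e0; pose proof (Cmod_ge_0 (den (f n) (al n))) as D0.
  set (D := Cmod (den (f n) (al n))) in *; set (x := Cmod (E n)) in *.
  set (y := Cmod (cd (f n) * bet (f n) - cb (f n))%C) in *.
  apply Rle_trans with (x * D * (Cmod (cb (f n)) * x + Cmod (d n) * y)).
  { apply Rmult_le_compat_l; [nra|auto]. }
  replace (x * D * (Cmod (cb (f n)) * x + Cmod (d n) * y))
    with (D * Cmod (cb (f n)) * x ^ 2 + x * Cmod (d n) * (y * D)) by ring.
  rewrite Hinv.
  assert (D * Cmod (cb (f n)) * x ^ 2 <= K * x ^ 2) by (apply Rmult_le_compat_r; nra).
  assert (K * x ^ 2 <= K * (K * (m (S n) - m n))) by (apply Rmult_le_compat_l; lra).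
  nra.
Qed.

(** Eventually [f (S n)] maps [al (S n)] to [bet (f (S n)) = al n], so [F_{n+1}(al n)] no longer
    depends on [n]. Adding up the tangency steps bounds its reciprocal distance to the orbit of [0],
    which keeps it off [q]. *)
Lemma tangency_point (q : C) : Ctends (fun n => ev (P n) 0) q ->
  exists e N, e <> q /\ (forall n, (n >= N)%nat -> Fcomp f (S n) (al n) = e) /\
    (forall n, exists w : C, Cmod w <= 1 /\ Fcomp f n w = e).
Proof.
  intros Hq; destruct eventually_al_eq_bet as [N HN].
  assert (Hal : forall n, (n >= N)%nat -> Cmod (al n) <= 1).
  { intros n Hn; destruct (HN n Hn) as [Ht _]; destruct (touching_alp (f n) (Hf n) Ht) as [H _].
    unfold al; lra. }
  set (e := ev (P (S N)) (al N)).
  assert (He : forall n, (n >= N)%nat -> ev (P (S n)) (al n) = e).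
  { intros n Hn; induction Hn as [|n Hn IH]; [reflexivity|].
    rewrite <- IH; destruct (HN n Hn) as [_ Hab]; destruct (HN (S n) ltac:(lia)) as [Ht _].
    destruct (touching_alp (f (S n)) (Hf (S n)) Ht) as (Ha & Hd & Hev).
    assert (Eq : ev (P (S (S n))) (al (S n)) = ev (P (S n)) (ev (f (S n)) (al (S n)))).
    { unfold P at 1; cbn [prodmob]; apply ev_mobmul; auto.
      apply seq_den_neq0; unfold al; rewrite Hev, <- Hab; apply Hal; lia. }
    rewrite Eq; unfold al at 1; rewrite Hev, <- Hab; reflexivity. }
  exists e, N; split; [|split].
  - set (T := Cmod (E (S N)) * Cmod (d (S N)) + K ^ 2 * M).
    assert (HT : forall n, (n >= S N)%nat -> Cmod (E n) * Cmod (d n) <= T).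
    { assert (HT' : forall n, (n >= S N)%nat ->
        Cmod (E n) * Cmod (d n) <= Cmod (E (S N)) * Cmod (d (S N)) + K ^ 2 * (m n - m (S N))).
      { intros n Hn; induction Hn as [|n Hn IH]; [lra|].
        destruct (HN n ltac:(lia)) as [Ht Hab]; pose proof (tangency_step n Ht Hab); lra. }
      intros n Hn; specialize (HT' n Hn); specialize (HM n); pose proof (seq_m_ge1 (S N)).
      assert (K ^ 2 * (m n - m (S N)) <= K ^ 2 * M) by (apply Rmult_le_compat_l; nra).
      unfold T; lra. }
    assert (Hfar : forall n, (n >= S N)%nat -> / T <= Cmod (e - ev (P n) 0)%C).
    (* The shift matters: [al n = bet (f (S n))], so [e] is the value of [F_{n+1}] at the point
       where [E (S n)] is evaluated. *)
    { intros [|n] Hn; [lia|].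
      destruct (HN n ltac:(lia)) as [Ht Hab]; destruct (HN (S n) ltac:(lia)) as [Ht' _].
      destruct (touching_bet (f (S n)) (Hf (S n)) Ht') as [Hb _].
      rewrite <- (He n) by lia; rewrite Hab, ev_minus_ev0 by lra.
      fold (E (S n)); rewrite Hb; unfold Rdiv; rewrite Rmult_1_l.
      pose proof (E_lower (S n) Ht').
      apply Rinv_le_contravar; [lra | apply HT; auto]. }
    assert (HTp : 0 < T).
    { specialize (HT (S N) (le_n _)); destruct (HN (S N) ltac:(lia)) as [Ht _]; pose proof (E_lower (S N) Ht); lra. }
    intros ->; destruct (Hq (/ T)) as [N2 H2]; [apply Rinv_0_lt_compat; auto|].
    specialize (H2 (max N2 (S N)) ltac:(lia)); specialize (Hfar (max N2 (S N)) ltac:(lia)).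
    cbv beta in H2; rewrite Cmod_minus_sym in H2; lra.
  - intros n Hn; rewrite Fcomp_prodmob by (auto; apply Hal; auto); apply He; auto.
  - intros n; set (l := max n N).
    assert (Hl : Fcomp f (S l) (al l) = e).
    { rewrite Fcomp_prodmob by (auto; apply Hal; lia); apply He; lia. }
    destruct (Fcomp_nested n (S l) (al l) ltac:(lia) (Hal l ltac:(lia))) as (w & Hw & Ew).
    exists w; split; auto; congruence.
Qed.

Lemma bounded_converges_ideally (q : C) : Ctends (fun n => ev (P n) 0) q -> converges_ideally f q.
Proof. intros Hq; apply converges_ideally_of_orbit; auto; apply d_diverges. Qed.

End Sequence.

(** * The theorem for generators of determinant of modulus one *)

Lemma chordal_Cmod (z w : C) :
  chordal z w = 2 * Cmod (z - w)%C / sqrt ((1 + Cmod z ^ 2) * (1 + Cmod w ^ 2)) /\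
  1 <= sqrt ((1 + Cmod z ^ 2) * (1 + Cmod w ^ 2)).
Proof.
  split.
  - unfold chordal; rewrite Cnorm_Cmod, !Cnorm2_Cmod; reflexivity.
  - apply Rle_trans with (sqrt (1 * 1)); [rewrite Rmult_1_l, sqrt_1; lra|].
    pose proof (pow2_ge_0 (Cmod z)); pose proof (pow2_ge_0 (Cmod w)).
    apply sqrt_le_1_alt, Rmult_le_compat; lra.
Qed.

Lemma chordal_lt (z w : C) (e : R) : Cmod (z - w)%C < e / 2 -> chordal z w < e.
Proof.
  destruct (chordal_Cmod z w) as [-> Hs]; intros H; pose proof (Cmod_ge_0 (z - w)).
  apply Rlt_div_l; nra.
Qed.

Lemma chordal_pos (z w : C) : z <> w -> 0 < chordal z w.
Proof.
  destruct (chordal_Cmod z w) as [-> Hs]; intros H.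
  apply Rdiv_lt_0_compat; [|lra].
  destruct (Rle_lt_dec (Cmod (z - w)%C) 0) as [Hle|]; [|lra].
  destruct H; apply Cmod_minus_le0; auto.
Qed.

Definition recurrent (f : nat -> Mob) (g : Mob) : Prop :=
  forall N, exists n, (n >= N)%nat /\ f n = g.

(** Each generator that is not recurrent is absent from some index on, and the finitely many such
    indices have a common bound. *)
Lemma eventually_recurrent (Fl : list Mob) (f : nat -> Mob) : (forall n, In (f n) Fl) ->
  exists N, forall n, (n >= N)%nat -> recurrent f (f n).
Proof.
  intros Hf.
  destruct (list_upper_bound Fl (fun g x => forall n, x <= INR n -> f n = g -> recurrent f g))
    as (x & _ & Hx).
  - intros g x y H Hxy n Hn; apply H; lra.
  - intros g _; destruct (classic (recurrent f g)) as [|Hr]; [exists 0; auto|].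
    apply not_all_ex_not in Hr; destruct Hr as [N HN].
    exists (INR N); intros n Hn E; exfalso; apply HN; exists n; split; auto.
    apply INR_le; auto.
  - destruct (INR_unbounded x) as [N HN]; exists N; intros n Hn.
    apply (Hx (f n) (Hf n) n); auto.
    apply le_INR in Hn; lra.
Qed.

Lemma Xset_unit (Fl : list Mob) (f : nat -> Mob) (x : Cpx) :
  (forall g, In g Fl -> unit_MD g) ->
  Xset Fl f x <-> exists g, In g Fl /\ recurrent f g /\ touching g /\ x = alp g.
Proof.
  intros HU; split.
  - intros (g & Hg & Hr & Ha & Hx); exists g.
    destruct (is_alpha_unique g x (HU g Hg) Ha Hx); auto.
  - intros (g & Hg & Hr & Ht & ->); exists g.
    destruct (is_alpha_alp g (HU g Hg) Ht); auto.
Qed.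

(** The cases are [m_n] unbounded and [m_n] bounded. For a point of [X], both sides of the final
    equivalence hold in the first case and both fail in the second. *)
Lemma unit_case (Fl : list Mob) (f : nat -> Mob)
  (HU : forall g, In g Fl -> unit_MD g) (Hf : forall n, In (f n) Fl) :
  exists q : Cpx, in_cldisc q /\
    converges_ideally f q /\
    loc_unif_conv f (fun z => in_cldisc z /\ ~ Xset Fl f z) q /\
    (forall x, Xset Fl f x -> (pt_conv f x q <-> limit_point_type f)).
Proof.
  assert (Hu : forall n, unit_MD (f n)) by auto.
  destruct (classic (forall M, exists n, mm (prodmob f n) > M)) as [Hunb|Hb].
  - destruct (unbounded_limit_point f Hu Hunb) as (q & Hq & Hid & Hunif & Hlp).
    exists q; split; [unfold in_cldisc; rewrite Cnorm_Cmod; auto|].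
    split; [auto|split].
    + intros z _; exists 1; split; [lra|]; intros eps Heps.
      destruct (Hunif (eps / 2)) as [N HN]; [lra|]; exists N; intros n Hn w [Hw _] _.
      unfold in_cldisc in Hw; rewrite Cnorm_Cmod in Hw; apply chordal_lt, HN; auto.
    + intros x Hx; apply Xset_unit in Hx; auto.
      destruct Hx as (g & Hg & _ & Ht & ->).
      split; [auto|intros _]; intros eps Heps.
      destruct (Hunif (eps / 2)) as [N HN]; [lra|]; exists N; intros n Hn.
      apply chordal_lt, HN; auto.
      destruct (touching_alp g (HU g Hg) Ht) as [Ha _]; lra.
  - apply not_all_ex_not in Hb; destruct Hb as [M HM0].
    assert (HM : forall n, mm (prodmob f n) <= M).
    { intros n; apply Rnot_gt_le; intros H; apply HM0; exists n; auto. }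
    destruct (list_upper_bound Fl (fun g K => unit_MD g -> gen_bound g K)) as (K & HK1 & HK).
    { intros g x y H Hxy Hg; apply gen_bound_mono with x; auto. }
    { intros g Hg; destruct (unit_MD_gen_bound g (HU g Hg)) as [K HK]; exists K; auto. }
    (* [/ L] separates distinct points [alp g] and [bet h] over the finitely many pairs of
       generators. *)
    destruct (list_upper_bound (list_prod Fl Fl)
      (fun p L => alp (fst p) <> bet (snd p) -> 1 <= L * Cmod (alp (fst p) - bet (snd p))%C))
      as (L & _ & HL).
    { intros p x y H Hxy Hp; specialize (H Hp).
      pose proof (Cmod_ge_0 (alp (fst p) - bet (snd p))); nra. }
    { intros p _; destruct (Rle_lt_dec (Cmod (alp (fst p) - bet (snd p))%C) 0) as [Hle|Hlt].
      - exists 0; intros Hne; destruct Hne; apply Cmod_minus_le0; auto.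
      - exists (/ Cmod (alp (fst p) - bet (snd p))%C); intros _; apply Req_le; field; lra. }
    assert (HKn : forall n, gen_bound (f n) K) by auto.
    assert (HLn : forall n k, alp (f n) <> bet (f k) -> 1 <= L * Cmod (alp (f n) - bet (f k))%C).
    { intros n k; apply (HL (f n, f k)), in_prod; auto. }
    destruct (orbit_converges f Hu K M HK1 HKn HM) as [q Hq].
    destruct (tangency_point f Hu K L M HK1 HKn HLn HM q Hq) as (e & N0 & Heq & He & Hei).
    pose proof (seq_limit_in_images f Hu q Hq) as Hqi.
    exists q; split; [unfold in_cldisc; rewrite Cnorm_Cmod; apply (seq_limit_cldisc f Hu q Hq)|].
    split; [apply (bounded_converges_ideally f Hu K M HK1 HKn HM q Hq)|split].
    + intros z [Hz HzX].
      destruct (eventually_recurrent Fl f Hf) as [N1 HN1].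
      destruct (eventually_touching f Hu K M HK1 HKn HM) as [N2 HN2].
      (* [z] is at distance at least [/ x] from every exceptional point. Points within [/ (2 * x)]
         of [z] are then still [/ (2 * x)] away from them. *)
      destruct (list_upper_bound Fl (fun g x => recurrent f g -> touching g ->
        1 <= x * Cmod ((z : C) - alp g)%C)) as (x & Hx1 & Hx).
      { intros g x y H Hxy Hr Ht; specialize (H Hr Ht); pose proof (Cmod_ge_0 ((z : C) - alp g)%C); nra. }
      { intros g Hg; destruct (Rle_lt_dec (Cmod ((z : C) - alp g)%C) 0) as [Hle|Hlt].
        - exists 0; intros Hr Ht; destruct HzX; apply Xset_unit; auto.
          exists g; repeat split; auto; apply Cmod_minus_le0; auto.
        - exists (/ Cmod ((z : C) - alp g)%C); intros _ _; apply Req_le; field; lra. }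
      assert (Hr : / (2 * x) > 0) by (apply Rinv_0_lt_compat; lra).
      exists (/ (2 * x)); split; [auto|]; intros eps Heps.
      destruct (uniform_away_from_al f Hu K M HK1 HKn HM q (/ (2 * x)) (eps / 2) Hq Hr) as [N3 HN3]; [lra|].
      (* The estimate concerns [F_{n+1}], whose last factor is [f n], hence the successor. *)
      exists (S (max N3 (max N1 N2))); intros [|n] Hn w [Hw _] Hwz; [lia|].
      unfold in_cldisc in Hw; rewrite Cnorm_Cmod in Hw, Hwz.
      apply chordal_lt, HN3; auto; [lia|].
      specialize (Hx (f n) (Hf n) (HN1 n ltac:(lia)) (HN2 n ltac:(lia))).
      change (Csub w z) with ((w : C) - z)%C in Hwz.
      pose proof (Cmod_minus_triangle z w (alp (f n))) as Htr.
      rewrite Cmod_minus_sym in Hwz.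
      assert (2 * / (2 * x) <= Cmod ((z : C) - alp (f n))%C); [|lra].
      replace (2 * / (2 * x)) with (/ x) by (field; lra).
      apply Rmult_le_reg_l with x; [lra|]; rewrite Rinv_r; lra.
    + intros x Hx; apply Xset_unit in Hx; auto.
      destruct Hx as (g & Hg & Hr & Ht & ->); split.
      (* At the infinitely many [n] with [f n = g], the value [F_{n+1}(alp g)] is [e], at fixed
         positive chordal distance from [q]. *)
      * intros Hpt; exfalso.
        destruct (Hpt (chordal e q)) as [N HN]; [apply chordal_pos; auto|].
        destruct (Hr (max N N0)) as (n & Hn & En).
        specialize (HN (S n) ltac:(lia)); specialize (He n ltac:(lia)).
        rewrite En in He; rewrite He in HN; lra.
      (* The distinct points [e] and [q] both lie in every image of the closed disc. *)
      * intros [p Hp]; exfalso; apply Heq.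
        assert (Hall : forall y : C, (forall n, exists w : C, Cmod w <= 1 /\ Fcomp f n w = y) -> y = p).
        { intros y Hy; apply Hp; intros n; destruct (Hy n) as (w & Hw & E).
          exists w; split; auto; unfold in_cldisc; rewrite Cnorm_Cmod; auto. }
        rewrite (Hall e Hei), (Hall q Hqi); reflexivity.
Qed.

(** * Normalising the determinant *)

Definition scaling (g : Mob) : R := / sqrt (Cmod (cdet g)).
Definition normalize (g : Mob) : Mob :=
  let r := RtoC (scaling g) in ((r * ca g, r * cb g, r * cc g), r * cd g)%C.

Lemma scaling_pos (g : Mob) : cdet g <> 0%C -> 0 < scaling g.
Proof. intros H; apply Rinv_0_lt_compat, sqrt_lt_R0, Cmod_pos; auto. Qed.

Lemma normalize_det (g : Mob) : cdet (normalize g) = (RtoC (scaling g ^ 2) * cdet g)%C.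
Proof.
  unfold normalize, cdet; cbn; unfold ca, cb, cc, cd; cbn.
  replace (RtoC (scaling g * (scaling g * 1))) with (RtoC (scaling g) * RtoC (scaling g))%C
    by (rewrite <- RtoC_mult; f_equal; ring).
  ring.
Qed.

Lemma normalize_det_mod (g : Mob) : cdet g <> 0%C -> Cmod (cdet (normalize g)) = 1.
Proof.
  intros H; pose proof (Cmod_pos _ H) as Hp; pose proof (sqrt_lt_R0 _ Hp).
  rewrite normalize_det, Cmod_mult, Cmod_R, Rabs_pos_eq by apply pow2_ge_0.
  unfold scaling; rewrite <- (pow2_sqrt (Cmod (cdet g))) at 2 by lra; field; lra.
Qed.

Lemma den_normalize (g : Mob) (z : C) : den (normalize g) z = (RtoC (scaling g) * den g z)%C.
Proof. unfold den; cbn; ring. Qed.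

(** The case [y = 0] relies on [/ 0 = 0]; it lets normalisation preserve [mob_eval] at the pole as
    well. *)
Lemma Cdiv_cancel_l (r x y : C) : r <> 0%C -> ((r * x) / (r * y) = x / y)%C.
Proof.
  intros Hr; destruct (classic (y = 0%C)) as [->|Hy]; [|field; auto].
  assert (E : (/ 0 = 0)%C) by (unfold Cinv, RtoC; simpl; f_equal; unfold Rdiv; ring).
  rewrite Cmult_0_r; unfold Cdiv; rewrite E; ring.
Qed.

Lemma mob_eval_normalize (g : Mob) (z : Cpx) : cdet g <> 0%C ->
  mob_eval (normalize g) z = mob_eval g z.
Proof.
  intros H; rewrite !mob_eval_ev; unfold ev; rewrite den_normalize.
  replace (ca (normalize g) * z + cb (normalize g))%C
    with (RtoC (scaling g) * (ca g * z + cb g))%C by (cbn; ring).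
  apply Cdiv_cancel_l, RtoC_neq0, Rgt_not_eq, scaling_pos; auto.
Qed.

Lemma mob_ext_normalize (g : Mob) (Q : H3) : cdet g <> 0%C ->
  mob_ext (normalize g) Q = mob_ext g Q.
Proof.
  intros H; destruct Q as [z t]; pose proof (scaling_pos g H) as Hs.
  assert (Hs2 : RtoC (scaling g ^ 2) <> 0%C) by (apply RtoC_neq0, pow_nonzero, Rgt_not_eq; auto).
  rewrite !mob_ext_C.
  assert (Ee : extden (normalize g) z t = scaling g ^ 2 * extden g z t).
  { unfold extden; rewrite den_normalize.
    replace (cc (normalize g)) with (RtoC (scaling g) * cc g)%C by reflexivity.
    rewrite !Cmod_mult, !Cmod_R, Rabs_pos_eq by lra; ring. }
  rewrite Ee; f_equal.
  - rewrite RtoC_mult, <- (Cdiv_cancel_l _ _ (RtoC (extden g z t)) Hs2); f_equal.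
    rewrite den_normalize.
    replace (ca (normalize g)) with (RtoC (scaling g) * ca g)%C by reflexivity.
    replace (cb (normalize g)) with (RtoC (scaling g) * cb g)%C by reflexivity.
    replace (cc (normalize g)) with (RtoC (scaling g) * cc g)%C by reflexivity.
    rewrite !Cmult_conj, !Cconj_RtoC.
    replace (RtoC (scaling g ^ 2)) with (RtoC (scaling g) * RtoC (scaling g))%C
      by (rewrite <- RtoC_mult; f_equal; ring).
    ring.
  - rewrite normalize_det, Cmod_mult, Cmod_R, Rabs_pos_eq by apply pow2_ge_0.
    unfold Rdiv; rewrite Rinv_mult; generalize (/ extden g z t); intros e; field; lra.
Qed.

Lemma in_MD_cdet (g : Mob) : in_MD g -> cdet g <> 0%C.
Proof. intros [H _]; exact H. Qed.

Lemma normalize_unit_MD (g : Mob) : in_MD g -> unit_MD (normalize g).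
Proof.
  intros Hg; pose proof (in_MD_cdet g Hg) as H0; pose proof (normalize_det_mod g H0) as H1.
  split; auto; destruct Hg as (_ & Hin & w & Hw & Hout); split; [|split].
  - change (cdet (normalize g) <> 0%C); apply Cmod_neq0; lra.
  - intros z Hz; destruct (Hin z Hz) as [Hd He]; rewrite mob_eval_normalize by auto; split; auto.
    change (den (normalize g) z <> 0%C); rewrite den_normalize; apply Cmult_neq_0; auto.
    apply RtoC_neq0, Rgt_not_eq, scaling_pos; auto.
  - exists w; split; auto; intros z Hz; rewrite mob_eval_normalize by auto; auto.
Qed.

Lemma is_alpha_normalize (g : Mob) (x : Cpx) : cdet g <> 0%C ->
  is_alpha (normalize g) x <-> is_alpha g x.
Proof.
  intros H; unfold is_alpha, tangent.
  assert (E : mob_eval (normalize g) = mob_eval g)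
    by (apply functional_extensionality; intros; apply mob_eval_normalize; auto).
  rewrite E; reflexivity.
Qed.

Theorem theorem1p6 (Fl : list Mob) (f : nat -> Mob)
  (HF : forall g, In g Fl -> in_MD g)
  (Hf : forall n, In (f n) Fl) :
  exists q : Cpx, in_cldisc q /\
    converges_ideally f q /\
    loc_unif_conv f (fun z => in_cldisc z /\ ~ Xset Fl f z) q /\
    (forall x, Xset Fl f x -> (pt_conv f x q <-> limit_point_type f)).
Proof.
  assert (H0 : forall n, cdet (f n) <> 0%C) by (intros; apply in_MD_cdet; auto).
  set (Fl' := map normalize Fl); set (f' := fun n => normalize (f n)).
  assert (EF : Fcomp f' = Fcomp f).
  { apply functional_extensionality; intros n; induction n as [|n IH];
      apply functional_extensionality; intros z; cbn [Fcomp]; auto.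
    rewrite IH; unfold f'; rewrite mob_eval_normalize; auto. }
  assert (EX : Fext f' = Fext f).
  { apply functional_extensionality; intros n; induction n as [|n IH];
      apply functional_extensionality; intros Q; cbn [Fext]; auto.
    rewrite IH; unfold f'; rewrite mob_ext_normalize; auto. }
  assert (HX : forall x, Xset Fl' f' x <-> Xset Fl f x).
  { intros x; split; intros (g & Hg & Hr & Ha & Hx).
    (* Several generators may share one normalisation, so recurrence of the normalised map does not
       single out a recurrent generator. An occurrence at a late index does, since there [f n]
       itself is recurrent. *)
    - destruct (eventually_recurrent Fl f Hf) as [N HN].
      destruct (Hr N) as (n & Hn & <-).
      exists (f n); split; [auto|split; [apply HN; auto|split; auto]].
      apply is_alpha_normalize; auto.
    - exists (normalize g); split; [apply in_map; auto|split; [|split; auto]].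
      + intros N; destruct (Hr N) as (n & Hn & <-); exists n; auto.
      + apply is_alpha_normalize; auto; apply in_MD_cdet; auto. }
  destruct (unit_case Fl' f') as (q & Hq & Hid & Hloc & Hpt).
  { intros g Hg; apply in_map_iff in Hg; destruct Hg as (h & <- & Hh); apply normalize_unit_MD; auto. }
  { intros n; apply (in_map normalize); auto. }
  unfold converges_ideally, loc_unif_conv, pt_conv, limit_point_type in *.
  rewrite EF, EX in *.
  exists q; split; [auto|split; [auto|split]].
  - intros z [Hz HzX].
    destruct (Hloc z) as (r & Hr & HN); [split; auto; rewrite HX; auto|].
    exists r; split; auto; intros eps Heps; destruct (HN eps Heps) as [N HN']; exists N.
    intros n Hn w [Hw HwX]; apply HN'; auto; split; auto; rewrite HX; auto.
  - intros x Hx; apply Hpt, HX; auto.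
Qed.
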